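(* Let $n\ge 0$ and $x\ge 1$ be integers. The number of centered vertically symmetric rhombus tilings of a $(2n+1,2x,2n+1)$ hexagon equals $Q(n+1,x)\cdot ST(2n+1,2x,2n+1)$.
   Context: For positive integers $a,b,c$, an $(a,b,c)$ hexagon is the equi-angular hexagon (on the triangular lattice) with side lengths $a,b,c,a,b,c$ in clockwise order starting from the southwestern side, so that the sides of length $b$ are vertical. A rhombus tiling is a tiling of the hexagon by unit rhombi (lozenges) with angles $60^\circ$ and $120^\circ$. A tiling is vertically symmetric if it is invariant under reflection in the vertical symmetry axis of the hexagon. When $a$ and $b$ have opposite parity, an $(a,b,a)$ hexagon has a central rhombus (the unit rhombus centered at the center of the hexagon); a tiling is centered if it contains this central rhombus. Notation: $(a)_k=a(a+1)\cdots(a+k-1)$ for $k\ge1$, $(a)_0=1$; $ST(a,b,a)=\prod_{i=1}^a\frac{2i+b-1}{2i-1}\prod_{1\le i<j\le a}\frac{i+j+b-1}{i+j-1}$ (the number of vertically symmetric rhombus tilings of an $(a,b,a)$ hexagon); and for nonnegative integers $n,x$, $Q(n,x)=\frac12\frac{(2n)!^2(2x)!(x+2n-1)!}{n!^2\,x!\,(2x+4n-2)!}\sum_{i=0}^{n-1}\frac{(-1)^{n-i-1}}{2n-2i-1}\frac{(x+n-i)_{2i}}{i!^2}$. *)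

(* Defs.v *)
From HB Require Import structures.
From mathcomp Require Import all_boot all_order all_algebra.
Set Implicit Arguments. Unset Strict Implicit. Unset Printing Implicit Defensive.
Import Order.TTheory GRing.Theory Num.Theory.

(* Triangular lattice with vertical lattice lines.                           *)
(* Vertical lattice lines are indexed by k : nat (x-coordinate k*sqrt3/2).   *)
(* Heights are doubled: a lattice point (k,Y) has y-coordinate Y/2.          *)
(* For the (a,b,c) hexagon the vertices are                                  *)
(*   bottom (a,0), lower-left (0,a), upper-left (0,a+2b), top (c,a+2b+c),    *)
(*   upper-right (a+c,2b+c), lower-right (a+c,c)                             *)
(* (sides SW=a, W=b (vertical), NW=c, NE=a, E=b, SE=c, clockwise from SW);  *)
(* lattice points on line k are those with Y = k + a (mod 2).               *)
(* Unit triangles in the strip between lines k and k+1 are indexed by        *)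
(* (k,Y): the triangle is left-pointing (apex (k,Y), base on line k+1 from   *)
(* Y-1 to Y+1) if Y = k + a (mod 2), and right-pointing (apex (k+1,Y), base  *)
(* on line k from Y-1 to Y+1) otherwise.                                     *)

Definition tri := (nat * nat)%type.

(* lowest and highest triangle index in strip k of the (a,b,c) hexagon *)
Definition lo (a k : nat) : nat := maxn (a - k) (k - a + 1).
Definition hi (a b c k : nat) : nat :=
  if k < c then a + 2 * b + k else a + 2 * b + 2 * c - k - 1.

Definition in_hex (a b c : nat) (t : tri) : bool :=
  (t.1 < a + c) && (lo a t.1 <= t.2 <= hi a b c t.1).

Definition left_pointing (a : nat) (t : tri) : bool := ~~ odd (t.2 + t.1 + a).

(* t1, t2 share an edge (t1 listed first): either consecutive in a strip,   *)
(* or t1 left-pointing and t2 the right-pointing triangle across its        *)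
(* vertical base.  A unit rhombus is such an adjacent pair.                 *)
Definition adj (a : nat) (t1 t2 : tri) : bool :=
  ((t2.1 == t1.1) && (t2.2 == t1.2.+1))
  || [&& left_pointing a t1, t2.1 == t1.1.+1 & t2.2 == t1.2].

Definition bnd (a b c : nat) : nat := (a + 2 * b + 2 * c + 1)%N.
Definition Tri (N : nat) := ('I_N * 'I_N)%type.
Definition tv (N : nat) (t : Tri N) : tri := (val t.1, val t.2).

Definition is_tiling (a b c : nat) (S : {set Tri (bnd a b c) * Tri (bnd a b c)}) : bool :=
  [forall r in S, [&& in_hex a b c (tv r.1), in_hex a b c (tv r.2)
                    & adj a (tv r.1) (tv r.2)]]
  && [forall t : Tri (bnd a b c), in_hex a b c (tv t) ==>
        (#|[set r in S | (r.1 == t) || (r.2 == t)]| == 1%N)].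

Definition has_tile (N : nat) (S : {set Tri N * Tri N}) (p q : tri) : bool :=
  [exists r in S, ((tv r.1 == p) && (tv r.2 == q)) || ((tv r.1 == q) && (tv r.2 == p))].

(* reflection in the vertical symmetry axis (line k = a) of an (a,b,a)      *)
(* hexagon: strip k goes to strip 2a-1-k, heights are preserved *)
Arguments has_tile : clear implicits.
Arguments is_tiling : clear implicits.
Definition refl (a : nat) (t : tri) : tri := (2 * a - 1 - t.1, t.2).

Definition vsym (a : nat) (N : nat) (S : {set Tri N * Tri N}) : bool :=
  [forall r in S, has_tile N S (refl a (tv r.1)) (refl a (tv r.2))].

(* central rhombus of an (a,b,a) hexagon (a, b of opposite parity): the     *)
(* vertical rhombus centred at (a, a+b), made of triangles (a-1,a+b) and    *)
(* (a,a+b) *)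
Definition centered (a b : nat) (N : nat) (S : {set Tri N * Tri N}) : bool :=
  has_tile N S (a - 1, a + b) (a, a + b).

Arguments vsym : clear implicits.
Arguments centered : clear implicits.

Definition num_cvs (a b : nat) : nat :=
  #|[set S : {set Tri (bnd a b a) * Tri (bnd a b a)} |
      [&& is_tiling a b a S, vsym a (bnd a b a) S & centered a b (bnd a b a) S]]|.

Local Open Scope ring_scope.

Definition rising (a k : nat) : rat := \prod_(j < k) (a + j)%:R.

Definition ST (a b : nat) : rat :=
  (\prod_(1 <= i < a.+1) ((2 * i + b - 1)%N%:R / (2 * i - 1)%N%:R))
  * (\prod_(1 <= j < a.+1) \prod_(1 <= i < j)
        ((i + j + b - 1)%N%:R / (i + j - 1)%N%:R)).

Definition Q (n x : nat) : rat :=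
  (1 / 2) * (((2 * n)`! ^ 2 * (2 * x)`! * (x + 2 * n - 1)`!)%N%:R
             / ((n`! ^ 2 * x`! * (2 * x + 4 * n - 2)`!)%N%:R))
  * \sum_(i < n) ((-1) ^+ (n - i - 1)%N / (2 * n - 2 * i - 1)%N%:R
                  * rising (x + n - i) (2 * i) / ((i`! ^ 2)%N%:R)).

(* Main.v *)
(** In the left half of a symmetric tiling, the horizontal rhombi crossing the
    vertical lattice lines 0, ..., a occupy interlacing sets of positions
    X_0, ..., X_a with |X_k| = k; these sets determine the tiling, which is
    centered iff the middle position lies in X_a.  The number of interlacing
    chains ending in X is the Vandermonde product vdm_prod(X) divided by
    0! 1! ... (a-1)!.  With N = n + x, the count is thus a sum of vdm_prod(X) over the
    subsets X of {-N, ..., N} of size 2n+1 that contain 0.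

    Let K be the reproducing kernel at 0 of the polynomials of degree at most 2n
    for the uniform weight on {-N, ..., N}.  Expanding vdm_prod in the point 0 through K,
    and summing by parts with alternating signs against the identity
    sum_{z in V} (-1)^{#{v in V : v < z}} g(z) vdm_prod(V \ z) = 0   (deg g < |V| - 1),
    one finds that the sum over the X containing 0 is K(0) times the sum over all X.
    The same summation by parts applied to the a-th monic orthogonal (discrete
    Chebyshev) polynomial p_a of squared norm h_a gives the ratio of the full sums
    for a + 1 and a points as h_a / (2 H_a(N)), where H_a(y) + H_a(y - 1) = p_a(y);
    this yields the product formula for ST.  Finally
    K(0) = sum_{i <= n} p_{2i}(0)^2 / h_{2i} equals Q(n+1, x) by a WZ certificate. *)

Require Import Defs.
From mathcomp Require Import all_boot all_order all_algebra.
From mathcomp Require Import perm ring lra zify.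

Set Implicit Arguments. Unset Strict Implicit. Unset Printing Implicit Defensive.
Import Order.TTheory GRing.Theory Num.Theory.

Local Open Scope ring_scope.

(** * Discrete Chebyshev polynomials *)

(** Coefficient in the three-term recurrence of the monic discrete Chebyshev (Gram) polynomials p_m,
    which are orthogonal for the uniform weight on -N, ..., N. *)
Definition cheb_coef (N m : nat) : rat :=
  m%:R ^+ 2 * ((2 * N%:R + 1) ^+ 2 - m%:R ^+ 2) / (4 * (4 * m%:R ^+ 2 - 1)).

Lemma cheb_coef0 N : cheb_coef N 0 = 0. Proof. by rewrite /cheb_coef expr0n !mul0r. Qed.

Fixpoint cheb (N m : nat) : {poly rat} :=
  match m with
  | 0 => 1
  | m1.+1 => match m1 with
             | 0 => 'X
             | m2.+1 => 'X * cheb N m1 - cheb_coef N m1 *: cheb N m2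
             end
  end.

Lemma four_sqr_sub1_neq0 (m : nat) : 4 * m%:R ^+ 2 - 1 != 0 :> rat.
Proof.
rewrite subr_eq0 -natrX -natrM (eqr_nat rat _ 1).
by apply/eqP=> /(congr1 odd); rewrite oddM.
Qed.

(** Together with [cheb_coef0], this is all that the induction for [cheb_opDE] uses about the
    coefficients. *)
Lemma cheb_coef_rec (N m : nat) :
  (4 * m%:R + 6) * cheb_coef N m.+1
  = (4 * m%:R - 2) * cheb_coef N m + 2 * N%:R * (N%:R + 1) - m%:R * (m%:R + 1).
Proof.
rewrite /cheb_coef; have := four_sqr_sub1_neq0 m; have := four_sqr_sub1_neq0 m.+1.
rewrite -!natr1 => h1 h2.
field; apply/andP; split=> //.
Qed.

Lemma cheb0 N : cheb N 0 = 1. Proof. by []. Qed.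
Lemma cheb1 N : cheb N 1 = 'X. Proof. by []. Qed.
Lemma chebSS N m :
  cheb N m.+2 = 'X * cheb N m.+1 - cheb_coef N m.+1 *: cheb N m.
Proof. by []. Qed.

Lemma cheb_eval N m y :
  (cheb N m.+2).[y] = y * (cheb N m.+1).[y] - cheb_coef N m.+1 * (cheb N m).[y].
Proof. by rewrite chebSS hornerD hornerN hornerZ hornerM hornerX. Qed.

(** The zeros at N and -N-1 kill the boundary terms of summations over the sites. *)
Definition cheb_wt (N : nat) (y : rat) : rat := (N%:R - y) * (N%:R + 1 + y).

Definition opD (N : nat) (p : {poly rat}) (y : rat) : rat :=
  cheb_wt N y * (p.[y + 1] - p.[y]) - cheb_wt N (y - 1) * (p.[y] - p.[y - 1]).

Definition opE (N : nat) (p : {poly rat}) (y : rat) : rat :=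
  cheb_wt N y * p.[y + 1] - cheb_wt N (y - 1) * p.[y - 1].

(* With y the multiplication by the variable, [D, y] = E and
   [E, y] = D + 2 (N (N + 1) - y ^ 2), so that the three-term recurrence propagates
   the two equations jointly. *)
Lemma cheb_opDE N m :
  [/\ forall y, opD N (cheb N m) y = - (m%:R * (m%:R + 1)) * (cheb N m).[y]
    , forall y, opD N (cheb N m.+1) y
                = - ((m%:R + 1) * (m%:R + 2)) * (cheb N m.+1).[y]
    , forall y, opE N (cheb N m) y
                = - 2 * (m%:R + 1) * (cheb N m.+1).[y]
                  + 2 * m%:R * (y * (cheb N m).[y] - (cheb N m.+1).[y])
    & forall y, opE N (cheb N m.+1) y
                = - 2 * (m%:R + 2) * (cheb N m.+2).[y]
                  + 2 * (m%:R + 1) * (cheb_coef N m.+1 * (cheb N m).[y])].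
Proof.
elim: m => [|m [D0 D1 E0 E1]].
  have Hb : 6 * cheb_coef N 1 = 2 * N%:R * (N%:R + 1) 
    by have := cheb_coef_rec N 0; rewrite cheb_coef0; lra.
  have h1 z : (1 : {poly rat}).[z] = 1 by rewrite -polyC1 hornerC.
  split=> y; rewrite /opD /opE ?cheb_eval ?cheb1 ?cheb0 /cheb_wt ?h1 ?hornerX; try ring.
  by move: (cheb_coef N 1) Hb => b Hb; nra.
have eqD : forall y, opD N (cheb N m.+2) y
   = y * opD N (cheb N m.+1) y + opE N (cheb N m.+1) y
     - cheb_coef N m.+1 * opD N (cheb N m) y.
  by move=> y; rewrite /opD /opE !cheb_eval; ring.
have eqE : forall y, opE N (cheb N m.+2) y
   = y * opE N (cheb N m.+1) y + opD N (cheb N m.+1) y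
     + (2 * N%:R * (N%:R + 1) - 2 * y ^+ 2) * (cheb N m.+1).[y]
     - cheb_coef N m.+1 * opE N (cheb N m) y.
  by move=> y; rewrite /opD /opE !cheb_eval /cheb_wt; ring.
have Hb := cheb_coef_rec N m.+1.
have mS : m.+1%:R = m%:R + 1 :> rat by rewrite natr1.
rewrite mS in Hb; have m0 : 0 <= m%:R :> rat by [].
split=> // y.
- by rewrite D1 mS; ring.
- by rewrite eqD D1 E1 D0 !cheb_eval mS; ring.
- rewrite E1 cheb_eval mS; ring.
- rewrite eqE E1 D1 E0 !cheb_eval mS.
  set b2 := cheb_coef N m.+2 in Hb *; set b1 := cheb_coef N m.+1 in Hb *.
  set u := (cheb N m.+1).[y]; set v := (cheb N m).[y].
  have -> : b2 = ((4 * (m%:R + 1) - 2) * b1 + 2 * N%:R * (N%:R + 1)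
    - (m%:R + 1) * (m%:R + 1 + 1)) / (4 * (m%:R + 1) + 6).
    rewrite -Hb; field.
    lra.
  field.
  lra.
Qed.

Lemma size_cheb_monic N m : size (cheb N m) = m.+1 /\ cheb N m \is monic.
Proof.
suff: (size (cheb N m) = m.+1 /\ cheb N m \is monic) /\
      (size (cheb N m.+1) = m.+2 /\ cheb N m.+1 \is monic) by case.
elim: m => [|m [[s0 m0] [s1 m1]]].
  by rewrite cheb0 cheb1 size_poly1 monic1 size_polyX monicX.
split=> //.
have sX : size ('X * cheb N m.+1) = m.+3.
  by rewrite mulrC size_mulX ?s1 // -size_poly_eq0 s1.
have lt : (size (- (cheb_coef N m.+1 *: cheb N m))%R < size ('X * cheb N m.+1)%R)%N.
  by rewrite sX size_polyN (leq_ltn_trans (size_scale_leq _ _)) // s0.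
rewrite chebSS size_polyDl // sX; split=> //.
by rewrite monicE lead_coefDl // mulrC lead_coefMX -monicE.
Qed.

Lemma size_cheb N m : size (cheb N m) = m.+1.
Proof. by case: (size_cheb_monic N m). Qed.

Lemma monic_cheb N m : cheb N m \is monic.
Proof. by case: (size_cheb_monic N m). Qed.

Lemma cheb_parity N m y : (cheb N m).[- y] = (-1) ^+ m * (cheb N m).[y].
Proof.
suff: (cheb N m).[- y] = (-1) ^+ m * (cheb N m).[y] /\
      (cheb N m.+1).[- y] = (-1) ^+ m.+1 * (cheb N m.+1).[y] by case.
elim: m => [|m [e0 e1]].
  by rewrite cheb0 cheb1 !hornerX -polyC1 !hornerC expr0 expr1; split; ring.
by split=> //; rewrite !cheb_eval e0 e1 !exprS; ring.
Qed.

(* The i-th site, in coordinates centered at 0. *)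
Definition site (N i : nat) : rat := i%:R - N%:R.

Definition ssum (N : nat) (F : rat -> rat) : rat :=
  \sum_(i < (2 * N).+1) F (site N i).

Lemma eq_ssum N F G : F =1 G -> ssum N F = ssum N G.
Proof. by move=> e; apply: eq_bigr => i _; rewrite e. Qed.

Lemma ssumD N F G : ssum N (fun y => F y + G y) = ssum N F + ssum N G.
Proof. exact: big_split. Qed.

Lemma ssumZ N c F : ssum N (fun y => c * F y) = c * ssum N F.
Proof. by rewrite /ssum mulr_sumr. Qed.

Lemma ssum0 N : ssum N (fun=> 0) = 0.
Proof. by rewrite /ssum big1. Qed.

Lemma ssum_telescope N (T : rat -> rat) :
  ssum N (fun y => T y - T (y - 1)) = T N%:R - T (- N%:R - 1).
Proof.
pose f k := T (k%:R - N%:R - 1).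
rewrite /ssum (eq_bigr (fun i : 'I__ => f i.+1 - f i)); last first.
  by move=> i _; rewrite /f /site -natr1; congr (T _ - T _); ring.
rewrite -(big_mkord xpredT (fun i => f i.+1 - f i)) telescope_sumr // /f.
by congr (T _ - T _); rewrite -?natr1 ?natrM; ring.
Qed.

(** Discrete Green identity: the summands differ by T(y) - T(y-1), and T vanishes with the weight at
    N and at -N-1. *)
Lemma opD_selfadjoint N p q :
  ssum N (fun y => opD N p y * q.[y]) = ssum N (fun y => p.[y] * opD N q y).
Proof.
pose T y := cheb_wt N y * (p.[y + 1] * q.[y] - p.[y] * q.[y + 1]).
apply/eqP; rewrite -subr_eq0 -[X in _ - X]mul1r -mulNr -ssumZ -ssumD.
rewrite (@eq_ssum _ _ (fun y => T y - T (y - 1))); last first.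
  by move=> y; rewrite /T /opD subrK; ring.
by rewrite ssum_telescope /T /cheb_wt; apply/eqP; ring.
Qed.

Lemma cheb_eigen N m y :
  opD N (cheb N m) y = - (m%:R * (m%:R + 1)) * (cheb N m).[y].
Proof. by case: (cheb_opDE N m). Qed.

(** Eigenvectors of a self-adjoint operator for the distinct eigenvalues -m(m+1) and -k(k+1). *)
Lemma cheb_ortho N m k : m != k ->
  ssum N (fun y => (cheb N m).[y] * (cheb N k).[y]) = 0.
Proof.
move=> left_strip; have := opD_selfadjoint N (cheb N m) (cheb N k).
rewrite (@eq_ssum _ _ (fun y => - (m%:R * (m%:R + 1)) *
   ((cheb N m).[y] * (cheb N k).[y]))); last first.
  by move=> y; rewrite cheb_eigen mulrA.
rewrite [RHS](@eq_ssum _ _ (fun y => - (k%:R * (k%:R + 1)) *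
   ((cheb N m).[y] * (cheb N k).[y]))); last first.
  by move=> y; rewrite cheb_eigen; ring.
rewrite !ssumZ => /eqP; rewrite -subr_eq0 -mulrBl mulf_eq0 => /orP[|/eqP //].
have -> : - (m%:R * (m%:R + 1)) - - (k%:R * (k%:R + 1))
        = (k%:R - m%:R) * (k + m + 1)%:R :> rat by rewrite !natrD; ring.
by rewrite mulf_eq0 subr_eq0 eqr_nat eq_sym (negPf left_strip) pnatr_eq0 addn1.
Qed.

Definition cnorm N m := ssum N (fun y => (cheb N m).[y] ^+ 2).

Lemma cnorm0 N : cnorm N 0 = 2 * N%:R + 1.
Proof.
rewrite /cnorm (@eq_ssum _ _ (fun=> 1)) => [|y].
  by rewrite /ssum sumr_const card_ord -addn1 natrD natrM.
by rewrite cheb0 -polyC1 hornerC expr1n.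
Qed.

(** The sum of p_(m+1) y p_m is evaluated twice, by the recurrence for p_(m+1) and by the one for
    p_(m+2). *)
Lemma cnormS N m : cnorm N m.+1 = cheb_coef N m.+1 * cnorm N m.
Proof.
transitivity (ssum N (fun y => (cheb N m.+1).[y] * (y * (cheb N m).[y]))).
  case: m => [|m].
    apply: eq_ssum => y.
    by rewrite cheb1 cheb0 hornerX -polyC1 hornerC; ring.
  rewrite -[LHS]addr0 -(mulr0 (cheb_coef N m.+1)) -(@cheb_ortho N m.+2 m).
    by rewrite -ssumZ -ssumD; apply: eq_ssum => y; rewrite !cheb_eval; ring.
  by rewrite neq_ltn; apply/orP; right; lia.
rewrite -[LHS]subr0 -(@cheb_ortho N m.+2 m); last first.
  by rewrite neq_ltn; apply/orP; right; lia.
rewrite /cnorm -ssumZ -[X in _ - X]mul1r -mulNr -ssumZ -ssumD.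
by apply: eq_ssum => y; rewrite !cheb_eval; ring.
Qed.

Lemma cheb_coef_gt0 N m : (0 < m <= 2 * N)%N -> 0 < cheb_coef N m.
Proof.
case/andP=> m0 mN; rewrite /cheb_coef.
have m1 : 1 <= m%:R :> rat by rewrite ler1n.
have m2 : m%:R <= 2 * N%:R :> rat by rewrite -natrM ler_nat.
apply: divr_gt0; last nra.
apply: mulr_gt0; nra.
Qed.

Lemma cnorm_gt0 N m : (m <= 2 * N)%N -> 0 < cnorm N m.
Proof.
elim: m => [_|m IH mN].
  by rewrite cnorm0; have : 0 <= N%:R :> rat by []; lra.
by rewrite cnormS mulr_gt0 ?cheb_coef_gt0 ?IH //; lia.
Qed.

(** Subtracting a multiple of the monic p_m removes the top coefficient, so a claim linear in f need
    only be checked on the p_k. *)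
Lemma cheb_basis_ind N (P : {poly rat} -> Prop) m :
  P 0 -> (forall k c (f : {poly rat}), (k < m)%N -> P f -> P (c *: cheb N k + f)) ->
  forall f : {poly rat}, (size f <= m)%N -> P f.
Proof.
move=> P0 PS; elim: m PS => [|m IH] PS f sf.
  by move: sf; rewrite leqn0 size_poly_eq0 => /eqP->.
have -> : f = f`_m *: cheb N m + (f - f`_m *: cheb N m) by rewrite addrC subrK.
apply: (PS) => //; apply: IH => [k c g km|]; first by apply: PS; lia.
apply/leq_sizeP => j mj; rewrite coefB coefZ.
case: (ltngtP m j) mj => // [mj _|-> _].
  rewrite (nth_default 0 (_ : size f <= j)%N); last by lia.
  by rewrite (nth_default 0 (_ : size (cheb N m) <= j)%N) ?size_cheb // mulr0 subr0.
by have := monic_cheb N j; rewrite monicE /lead_coef size_cheb => /eqP->; rewrite mulr1 subrr.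
Qed.

Lemma cheb_ortho_small N m (f : {poly rat}) : (size f <= m)%N ->
  ssum N (fun y => f.[y] * (cheb N m).[y]) = 0.
Proof.
move: f; apply: (@cheb_basis_ind N).
  by rewrite (@eq_ssum _ _ (fun=> 0)) ?ssum0 // => y; rewrite horner0 mul0r.
move=> k c f km Hf.
rewrite (@eq_ssum _ _ (fun y => c * ((cheb N k).[y] * (cheb N m).[y])
  + f.[y] * (cheb N m).[y])) => [|y]; last by rewrite hornerD hornerZ; ring.
by rewrite ssumD ssumZ Hf cheb_ortho ?mulr0 ?addr0 // neq_ltn km.
Qed.

Lemma ssum_monic_cheb N m (f : {poly rat}) : f \is monic -> size f = m.+1 ->
  ssum N (fun y => f.[y] * (cheb N m).[y]) = cnorm N m.
Proof.
move=> mf sf; have sd : (size (f - cheb N m)%R <= m)%N.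
  apply/leq_sizeP => j mj; rewrite coefB.
  case: (ltngtP m j) mj => // [mj _|<- _].
    by rewrite !nth_default ?size_cheb ?sf ?subr0.
  move: mf (monic_cheb N m); rewrite !monicE /lead_coef size_cheb sf.
  by move=> /eqP-> /eqP->; rewrite subrr.
rewrite -[RHS]add0r -(cheb_ortho_small N sd) -ssumD; apply: eq_ssum => y.
by rewrite hornerD hornerN; ring.
Qed.

(* Reproducing kernel at 0; the odd-degree terms vanish there. *)
Definition kernel0 N n : {poly rat} :=
  \sum_(i < n.+1) ((cheb N (2 * i)).[0] / cnorm N (2 * i)) *: cheb N (2 * i).

Lemma cheb_odd_at0 N m : odd m -> (cheb N m).[0] = 0.
Proof.
move=> om; have := cheb_parity N m 0.
by rewrite oppr0 -signr_odd om expr1; lra.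
Qed.

(** By linearity f may be taken to be p_k. Orthogonality leaves the term 2i = k, and for odd k both
    sides vanish. The bound n <= N makes the norms nonzero. *)
Lemma kernel0_reproducing N n (f : {poly rat}) : (n <= N)%N -> (size f <= (2 * n).+1)%N ->
  ssum N (fun y => (kernel0 N n).[y] * f.[y]) = f.[0].
Proof.
move=> nN; move: f; apply: (@cheb_basis_ind N).
  by rewrite horner0 (@eq_ssum _ _ (fun=> 0)) ?ssum0 // => y; rewrite horner0 mulr0.
move=> k c f kn Hf; rewrite hornerD hornerZ -Hf.
rewrite (@eq_ssum _ _ (fun y => c * ((kernel0 N n).[y] * (cheb N k).[y])
  + (kernel0 N n).[y] * f.[y])) => [|y]; last by rewrite hornerD hornerZ; ring.
rewrite ssumD ssumZ; congr (c * _ + _).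
rewrite (@eq_ssum _ _ (fun y => \sum_(i < n.+1) ((cheb N (2 * i)).[0] / cnorm N (2 * i))
  * ((cheb N (2 * i)).[y] * (cheb N k).[y]))) => [|y]; last first.
  by rewrite /kernel0 horner_sum mulr_suml; apply: eq_bigr => i _; rewrite hornerZ mulrA.
rewrite {1}/ssum exchange_big /=.
rewrite (eq_bigr (fun i : 'I_n.+1 => ((cheb N (2 * i)).[0] / cnorm N (2 * i))
  * ssum N (fun y => (cheb N (2 * i)).[y] * (cheb N k).[y]))); last first.
  by move=> i _; rewrite mulr_sumr.
case ok: (odd k).
  rewrite cheb_odd_at0 // big1 // => i _; rewrite cheb_ortho ?mulr0 //.
  by apply/eqP=> e; rewrite -e mul2n odd_double in ok.
have ek : k = (2 * k./2)%N by rewrite mul2n; have := odd_double_half k; rewrite ok.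
have kn' : (k./2 < n.+1)%N by lia.
rewrite (bigD1 (Ordinal kn')) //= big1 ?addr0 => [|i ik].
  rewrite -ek -[RHS]mulr1 -mulrA; congr (_ * _).
  rewrite mulrC; apply: divff; apply: lt0r_neq0; apply: cnorm_gt0; lia.
rewrite cheb_ortho ?mulr0 //; apply: contraNneq ik => e.
by apply/eqP/val_inj => /=; lia.
Qed.

(** Both shifts preserve the leading coefficient, which cancels. Against the quadratic weight in
    [half_cheb], this leaves a growth of one degree per step. *)
Lemma size_central_diff (p : {poly rat}) :
  (size ((p \Po ('X + 1%:P)) - (p \Po ('X - 1%:P)))%R <= (size p).-1)%N.
Proof.
have sh c : size (p \Po ('X + c%:P)) = size p.
  by rewrite size_comp_poly2 // size_XaddC.
have lc c : (p \Po ('X + c%:P))`_(size p).-1 = lead_coef p.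
  rewrite -{1}(sh c) -/(lead_coef _) lead_coef_comp ?size_XaddC //.
  by rewrite lead_coefXaddC expr1n mulr1.
apply/leq_sizeP => j pj; rewrite coefB -[- 1%:P]polyCN.
case: (leqP (size p) j) => [sj|js].
  by rewrite !nth_default ?subr0 // sh.
have -> : j = (size p).-1 by lia.
by rewrite !lc subrr.
Qed.

(** * Solutions of H(y) + H(y-1) = p_m(y) *)

Definition cheb_wtX (N : nat) : {poly rat} := (N%:R%:P - 'X) * ((N%:R + 1)%:P + 'X).

Lemma cheb_wtXE N y : (cheb_wtX N).[y] = cheb_wt N y.
Proof. by rewrite /cheb_wtX hornerM hornerD hornerN hornerD !hornerC !hornerX. Qed.

(* The solution of H(y) + H(y - 1) = p_m(y).  If H solves this for p_m, then
   G(y) = w(y) (H(y + 1) - H(y - 1)) satisfies G(y) + G(y - 1) = E p_m(y) + 2 y p_m(y),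
   a combination of p_(m+1) and p_(m-1); hence the recursion.  As w(N) = 0, G vanishes
   at N, which makes the values at N a first-order product. *)
Fixpoint half_cheb (N m : nat) : {poly rat} :=
  match m with
  | 0 => (2^-1)%:P
  | m1.+1 => match m1 with
    | 0 => 2^-1 *: ('X + (2^-1)%:P)
    | m2.+1 => (2 * m1%:R)^-1 *:
        ((2 * (m1%:R + 1) * cheb_coef N m1) *: half_cheb N m2
         - cheb_wtX N * ((half_cheb N m1 \Po ('X + 1%:P)) - (half_cheb N m1 \Po ('X - 1%:P))))
    end
  end.

Lemma hchebSS N m : half_cheb N m.+2 = (2 * m.+1%:R)^-1 *:
  ((2 * (m.+1%:R + 1) * cheb_coef N m.+1) *: half_cheb N m
   - cheb_wtX N * ((half_cheb N m.+1 \Po ('X + 1%:P)) - (half_cheb N m.+1 \Po ('X - 1%:P)))).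
Proof. by []. Qed.

Lemma hcheb_eval N m y : (half_cheb N m.+2).[y] = (2 * m.+1%:R)^-1 *
  (2 * (m.+1%:R + 1) * cheb_coef N m.+1 * (half_cheb N m).[y]
   - cheb_wt N y * ((half_cheb N m.+1).[y + 1] - (half_cheb N m.+1).[y - 1])).
Proof.
rewrite -cheb_wtXE hchebSS hornerZ hornerD hornerN hornerZ hornerM.
by rewrite hornerD hornerN !horner_comp hornerD hornerXsubC hornerX hornerC.
Qed.

Lemma hcheb0_eval N y : (half_cheb N 0).[y] = 2^-1.
Proof. by rewrite hornerC. Qed.

Lemma hcheb1_eval N y : (half_cheb N 1).[y] = 2^-1 * (y + 2^-1).
Proof. by rewrite hornerZ hornerD hornerX hornerC. Qed.

Lemma natS_neq0 m : m%:R + 1 != 0 :> rat.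
Proof. by rewrite natr1 pnatr_eq0. Qed.

Lemma hcheb_avg N m y : (half_cheb N m).[y] + (half_cheb N m).[y - 1] = (cheb N m).[y].
Proof.
suff: (forall y, (half_cheb N m).[y] + (half_cheb N m).[y - 1] = (cheb N m).[y]) /\
  (forall y, (half_cheb N m.+1).[y] + (half_cheb N m.+1).[y - 1] = (cheb N m.+1).[y]) by case.
elim: m => [|m [H0 H1]]; split=> // z.
- by rewrite !hcheb0_eval cheb0 -polyC1 hornerC; lra.
- by rewrite !hcheb1_eval cheb1 hornerX; lra.
(* In the equation for [opE] on p_(m+1), each p_j is replaced by H_j(z) + H_j(z-1); the claim is a
   linear rearrangement of it after multiplication by 2(m+1). *)
case: (cheb_opDE N m) => _ _ _ /(_ z); rewrite /opE -!H1 !hcheb_eval !addrK.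
have mS : m.+1%:R = m%:R + 1 :> rat by rewrite natr1.
have m0 := natS_neq0 m.
rewrite !cheb_eval -?H1 -?H0 ?subrK ?addrK ?mS.
set b := cheb_coef N m.+1.
move: (half_cheb N m.+1).[z] (half_cheb N m.+1).[z + 1] (half_cheb N m.+1).[z - 1]
  (half_cheb N m.+1).[z - 1 - 1] (half_cheb N m).[z] (half_cheb N m).[z - 1].
move=> u1 u2 u3 u4 v1 v2 E.
apply: (mulfI (_ : 2 * (m%:R + 1) != 0)); first by rewrite mulf_neq0.
rewrite mulrDr !mulVKf; try by rewrite mulf_neq0.
by move: E; rewrite /cheb_wt; lra.
Qed.

(** The reflection exchanges N and -N-1, the two ends of the summation by parts, so that their
    contributions combine. *)
Lemma hcheb_sym N m y : (half_cheb N m).[- 1 - y] = (-1) ^+ m * (half_cheb N m).[y].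
Proof.
suff: (forall y, (half_cheb N m).[- 1 - y] = (-1) ^+ m * (half_cheb N m).[y]) /\
  (forall y, (half_cheb N m.+1).[- 1 - y] = (-1) ^+ m.+1 * (half_cheb N m.+1).[y]) by case.
elim: m => [|m [H0 H1]]; split=> // z.
- by rewrite !hcheb0_eval; ring.
- by rewrite !hcheb1_eval; field.
rewrite !hcheb_eval H0.
have -> : -1 - z + 1 = - 1 - (z - 1) by ring.
have -> : -1 - z - 1 = - 1 - (z + 1) by ring.
by rewrite !H1 !exprS /cheb_wt; ring.
Qed.

Lemma size_hcheb N m : (size (half_cheb N m) <= m.+1)%N.
Proof.
suff: (size (half_cheb N m) <= m.+1)%N /\ (size (half_cheb N m.+1) <= m.+2)%N by case.
elim: m => [|m [H0 H1]]; split=> //.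
- exact: size_polyC_leq1.
- by apply: leq_trans (size_scale_leq _ _) _; rewrite size_XaddC.
rewrite hchebSS; apply: leq_trans (size_scale_leq _ _) _.
apply: leq_trans (size_polyD _ _) _; rewrite geq_max; apply/andP; split.
  by apply: leq_trans (size_scale_leq _ _) _; lia.
rewrite size_polyN; apply: leq_trans (size_polyMleq _ _) _.
have hd := size_central_diff (half_cheb N m.+1).
have hw : (size (cheb_wtX N) <= 3)%N.
  apply: leq_trans (size_polyMleq _ _) _.
  by rewrite -opprB size_polyN size_XsubC addrC size_XaddC.
apply: (@leq_trans (3 + (size (half_cheb N m.+1)).-1).-1)%N; last by lia.
by rewrite -!subn1 leq_sub2r // leq_add // subn1.
Qed.

Lemma hcheb_atN N m :
  (half_cheb N m.+2).[N%:R] = (m%:R + 2) / (m%:R + 1) * cheb_coef N m.+1 * (half_cheb N m).[N%:R].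
Proof.
rewrite hcheb_eval /cheb_wt subrr !mul0r subr0.
have -> : m.+1%:R = m%:R + 1 :> rat by rewrite natr1.
by field; exact: natS_neq0.
Qed.

Definition half_kernel0 N n : {poly rat} :=
  \sum_(i < n.+1) ((cheb N (2 * i)).[0] / cnorm N (2 * i)) *: half_cheb N (2 * i).

Lemma khalf_avg N n y : (half_kernel0 N n).[y] + (half_kernel0 N n).[y - 1] = (kernel0 N n).[y].
Proof.
rewrite !horner_sum -big_split; apply: eq_bigr => i _ /=.
by rewrite !hornerZ -mulrDr hcheb_avg.
Qed.

Lemma khalf_sym N n y : (half_kernel0 N n).[- 1 - y] = (half_kernel0 N n).[y].
Proof.
rewrite !horner_sum; apply: eq_bigr => i _ /=.
by rewrite !hornerZ hcheb_sym exprM sqrrN !expr1n mul1r.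
Qed.

Lemma size_khalf N n : (size (half_kernel0 N n) <= (2 * n).+1)%N.
Proof.
apply: leq_trans (size_sum _ _ _) _; apply/bigmax_leqP => i _.
apply: leq_trans (size_scale_leq _ _) _; apply: leq_trans (size_hcheb _ _) _.
by have := ltn_ord i; lia.
Qed.

Definition kernel0_term N i := (cheb N (2 * i)).[0] ^+ 2 / cnorm N (2 * i).

Lemma kernel0_at0 N n : (kernel0 N n).[0] = \sum_(i < n.+1) kernel0_term N i.
Proof.
by rewrite horner_sum; apply: eq_bigr => i _; rewrite hornerZ /kernel0_term; ring.
Qed.

(** At 0 the recurrence reads p_(2i+2)(0) = -b_(2i+1) p_(2i)(0) with b = [cheb_coef], while the norm
    gains the factor b_(2i+2) b_(2i+1). *)
Lemma kernel0_termS N i : (i < N)%N ->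
  kernel0_term N i.+1 = cheb_coef N (2 * i).+1 / cheb_coef N (2 * i).+2 * kernel0_term N i.
Proof.
move=> iN; rewrite /kernel0_term (_ : 2 * i.+1 = (2 * i).+2)%N; last by lia.
rewrite cheb_eval mul0r sub0r !cnormS.
have b1 : cheb_coef N (2 * i).+1 != 0 by apply/lt0r_neq0/cheb_coef_gt0; lia.
have b2 : cheb_coef N (2 * i).+2 != 0 by apply/lt0r_neq0/cheb_coef_gt0; lia.
have h : cnorm N (2 * i) != 0 by apply/lt0r_neq0/cnorm_gt0; lia.
by field; rewrite b1 b2 h.
Qed.

(** * Evaluation of the kernel at 0 as Q *)

Definition ratfact (k : nat) : rat := k`!%:R.

Lemma ratfactS k : ratfact k.+1 = (k%:R + 1) * ratfact k.
Proof. by rewrite /ratfact factS natrM natr1. Qed.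

Lemma ratfact_neq0 k : ratfact k != 0.
Proof. by rewrite /ratfact pnatr_eq0 -lt0n fact_gt0. Qed.

Definition Q_prefactor (n x : nat) : rat :=
  1 / 2 * ((ratfact (2 * n).+2 ^+ 2 * ratfact (2 * x) * ratfact (x + 2 * n).+1)
           / (ratfact n.+1 ^+ 2 * ratfact x * ratfact (2 * x + 4 * n).+2)).

Definition Q_summand (n x i : nat) : rat :=
  (-1) ^+ (n - i)%N / (2 * n%:R - 2 * i%:R + 1) * rising (x + n.+1 - i) (2 * i)
  / (i`!%:R ^+ 2).

Lemma Q_prefactorE n x : Q n.+1 x = Q_prefactor n x * \sum_(i < n.+1) Q_summand n x i.
Proof.
rewrite /Q /Q_prefactor /ratfact.
have -> : (2 * n.+1 = (2 * n).+2)%N by lia.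
have -> : (x + (2 * n).+2 - 1 = (x + 2 * n).+1)%N by lia.
have -> : (2 * x + 4 * n.+1 - 2 = (2 * x + 4 * n).+2)%N by lia.
rewrite !(natrX, natrM); congr (_ * _); apply: eq_bigr => i _; rewrite /Q_summand natrX.
have -> : (n.+1 - i - 1 = n - i)%N by lia.
congr (_ / _ * _ / _).
have -> : ((2 * n).+2 - 2 * i - 1 = (2 * n + 1) - 2 * i)%N by lia.
by rewrite natrB ?natrD ?natrM; [ring | have := ltn_ord i; lia].
Qed.

(** Passing from (n, x+1) to (n+1, x) keeps n + x, and with it the set of sites, fixed. *)
Lemma Q_prefactorS n x : Q_prefactor n.+1 x
  = (2 * n%:R + 3) ^+ 2 / ((2 * (x%:R + n%:R + 1) + 1) ^+ 2 - 4 * (n%:R + 1) ^+ 2)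
    * Q_prefactor n x.+1.
Proof.
rewrite /Q_prefactor.
have -> : (2 * n.+1 = (2 * n).+2)%N by lia.
have -> : (2 * x.+1 = (2 * x).+2)%N by lia.
have -> : (x + (2 * n).+2 = (x + 2 * n).+2)%N by lia.
have -> : (x.+1 + 2 * n = (x + 2 * n).+1)%N by lia.
have -> : (2 * x + 4 * n.+1 = (2 * x + 4 * n).+4)%N by lia.
have -> : ((2 * x).+2 + 4 * n = (2 * x + 4 * n).+2)%N by lia.
rewrite (ratfactS (2 * n).+3) (ratfactS (2 * n).+2) (ratfactS (2 * x).+1) (ratfactS (2 * x)).
rewrite (ratfactS (x + 2 * n).+2) (ratfactS n.+1) (ratfactS x).
rewrite (ratfactS (2 * x + 4 * n).+4.+1) (ratfactS (2 * x + 4 * n).+4).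
move: (ratfact_neq0 (2 * n).+2) (ratfact_neq0 (2 * x)) (ratfact_neq0 (x + 2 * n).+2)
  (ratfact_neq0 n.+1) (ratfact_neq0 x) (ratfact_neq0 (2 * x + 4 * n).+4).
move: (ratfact (2 * n).+2) (ratfact (2 * x)) (ratfact (x + 2 * n).+2)
  (ratfact n.+1) (ratfact x) (ratfact (2 * x + 4 * n).+4).
rewrite -[(2 * n).+3]addn3 -[(2 * n).+2]addn2 -[(2 * x).+1]addn1 -[(x + 2 * n).+2]addn2.
rewrite -[n.+1]addn1 -[(2 * x + 4 * n).+4]addn4 -[(2 * x + 4 * n + 4).+1]addn1.
rewrite !(natrM, natrD).
move=> f1 f2 f3 f4 f5 f6 h1 h2 h3 h4 h5 h6.
have n0 : 0 <= n%:R :> rat by [].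
have x0 : 0 <= x%:R :> rat by [].
move: (n%:R : rat) (x%:R : rat) n0 x0 => a b a0 b0.
field.
rewrite h4 h5 h6 /=; repeat (apply/andP; split); apply: lt0r_neq0; nra.
Qed.

(** The product of consecutive integers gains one factor at each end. *)
Lemma rising_step N i : (i <= N)%N ->
  rising (N - i) (2 * i.+1) = (N%:R - i%:R) * (N%:R + i%:R + 1) * rising (N.+1 - i) (2 * i).
Proof.
move=> iN; rewrite /rising (_ : 2 * i.+1 = (2 * i).+2)%N; last by lia.
rewrite big_ord_recr big_ord_recl /= addn0 natrB // mulrAC; congr (_ * _ * _).
  by rewrite -[1]/(1%:R) -!natrD; congr (_%:R); lia.
by apply: eq_bigr => j _; rewrite /bump /=; congr (_%:R); lia.
Qed.

(* Zeilberger recurrence in n with N = n + x fixed; the certificate is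
   - 4 k ^ 2 / (2 n + 3) ^ 2. *)
Lemma Q_summand_wz n x i : (i <= n)%N ->
  let G k := - (4 * k%:R ^+ 2) / (2 * n%:R + 3) ^+ 2 * (Q_prefactor n.+1 x * Q_summand n.+1 x k) in
  Q_prefactor n.+1 x * Q_summand n.+1 x i - Q_prefactor n x.+1 * Q_summand n x.+1 i = G i.+1 - G i.
Proof.
move=> in_ G; rewrite /G /Q_summand Q_prefactorS.
have -> : (x + n.+2 - i.+1 = (x + n.+1) - i)%N by lia.
rewrite rising_step; last by lia.
have -> : (x.+1 + n.+1 - i = (x + n.+1).+1 - i)%N by lia.
have -> : (x + n.+2 - i = (x + n.+1).+1 - i)%N by lia.
have -> : (n.+1 - i = (n - i).+1)%N by lia.
have -> : (n.+1 - i.+1 = n - i)%N by lia.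
rewrite [(-1) ^+ (n - i).+1]exprS factS natrM.
have iF : i`!%:R != 0 :> rat by rewrite pnatr_eq0 -lt0n fact_gt0.
move: (rising _ _) ((-1) ^+ _) (Q_prefactor _ _) (i`!%:R) iF => w s P f f0.
have -> : (x + n.+1)%:R = x%:R + n%:R + 1 :> rat by rewrite natrD -(natr1 n) addrA.
have -> : n.+1%:R = n%:R + 1 :> rat by rewrite natr1.
have -> : i.+1%:R = i%:R + 1 :> rat by rewrite natr1.
have i0 : 0 <= i%:R :> rat by [].
have x0 : 0 <= x%:R :> rat by [].
have in0 : i%:R <= n%:R :> rat by rewrite ler_nat.
move: (i%:R : rat) (x%:R : rat) (n%:R : rat) i0 x0 in0 => a b c a0 b0 ac.
field.
by rewrite f0 /=; repeat (apply/andP; split); apply: lt0r_neq0; nra.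
Qed.

(** The constant is 1 - 4n^2 / (2n+1)^2: in [Q_kernel0] the last summand of Q merges with the
    boundary value of the certificate. Both sides satisfy the same first-order recurrence in n with
    n + x fixed. *)
Lemma kernel0_term_closed n x :
  (4 * n%:R + 1) / (2 * n%:R + 1) ^+ 2 * (Q_prefactor n x * Q_summand n x n) = kernel0_term (n + x)
    n.
Proof.
elim: n x => [|n IH] x.
  rewrite /kernel0_term muln0 cheb0 -polyC1 hornerC expr1n cnorm0 /Q_summand /Q_prefactor.
  rewrite !muln0 addn0 !ratfactS /rising big_ord0.
  have := ratfact_neq0 (2 * x); have := ratfact_neq0 x; have := ratfact_neq0 0.
  rewrite !addn0 -[(2 * x).+1]addn1 natrD natrM fact0 expr0 add0n.
  have x0 : 0 <= x%:R :> rat by [].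
  move: (ratfact _) (ratfact x) (ratfact _) (x%:R : rat) x0 => f1 f2 f3 b b0 h1 h2 h3.
  by field; repeat (apply/andP; split); (assumption || (apply: lt0r_neq0; nra)).
rewrite addSnnS kernel0_termS; last by lia.
rewrite -IH Q_prefactorS /Q_summand.
have -> : (x + n.+2 - n.+1 = (n + x.+1) - n)%N by lia.
rewrite rising_step; last by lia.
have -> : (x.+1 + n.+1 - n = (n + x.+1).+1 - n)%N by lia.
rewrite !subnn expr0 factS natrM /cheb_coef.
have nF : n`!%:R != 0 :> rat by rewrite pnatr_eq0 -lt0n fact_gt0.
move: (rising _ _) (Q_prefactor _ _) (n`!%:R) nF => w P f f0.
rewrite -[(2 * n).+1]addn1 -[(2 * n + 1).+1]addn1 -[x.+1]addn1 -[n.+1]addn1 !(natrM, natrD).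
have n0 : 0 <= n%:R :> rat by [].
have x0 : 0 <= x%:R :> rat by [].
move: (x%:R : rat) (n%:R : rat) x0 n0 => b c b0 c0.
field.
rewrite f0 /=; repeat (apply/andP; split); apply: lt0r_neq0; nra.
Qed.

(** Induction on n with n + x fixed. By [Q_summand_wz] the difference of consecutive sums
    telescopes; G vanishes at 0, and its value at n+1 together with the summand i = n+1 is the new
    kernel term. *)
Lemma Q_kernel0 n x : Q n.+1 x = (kernel0 (n + x) n).[0].
Proof.
elim: n x => [|n IH] x; rewrite kernel0_at0.
  rewrite Q_prefactorE !big_ord1 -kernel0_term_closed mulr0 add0r.
  by rewrite -[LHS]mul1r; congr (_ * _); rewrite add0r expr1n divr1.
rewrite big_ord_recr /= -kernel0_at0 addSnnS -IH !Q_prefactorE -addSnnS -kernel0_term_closed.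
rewrite big_ord_recr /= mulrDr.
pose G k := - (4 * k%:R ^+ 2) / (2 * n%:R + 3) ^+ 2 * (Q_prefactor n.+1 x * Q_summand n.+1 x k).
have key : Q_prefactor n.+1 x * (\sum_(i < n.+1) Q_summand n.+1 x i)
    - Q_prefactor n x.+1 * (\sum_(i < n.+1) Q_summand n x.+1 i) = G n.+1 - G 0.
  rewrite !mulr_sumr -sumrB (eq_bigr (fun i : 'I_n.+1 => G i.+1 - G i)) => [|i _].
    by rewrite -(big_mkord xpredT (fun i => G i.+1 - G i)) telescope_sumr.
  by apply: Q_summand_wz; rewrite -ltnS.
apply: (addIr (- (Q_prefactor n x.+1 * (\sum_(i < n.+1) Q_summand n x.+1 i)))).
rewrite addrAC key /G.
have -> : n.+1%:R = n%:R + 1 :> rat by rewrite natr1.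
have n0 : 0 <= n%:R :> rat by [].
by field; apply: lt0r_neq0; lra.
Qed.

(** * Sums of Vandermonde products over subsets *)

Definition count_below (L : nat) (X : {set 'I_L}) (t : nat) : nat :=
  #|[set x in X | (x < t)%N]|.

Definition vdm_prod (L : nat) (X : {set 'I_L}) : rat :=
  \prod_(i in X) \prod_(j in X) (if (i < j)%N then j%:R - i%:R else 1).

Definition root_poly (N : nat) (X : {set 'I_(2 * N).+1}) : {poly rat} :=
  \prod_(x in X) ('X - (site N x)%:P).

Lemma count_below0 L (X : {set 'I_L}) : count_below X 0 = 0%N.
Proof. by rewrite /count_below; apply/eqP; rewrite cards_eq0; apply/eqP/setP=> x;
  rewrite !inE andbF. Qed.

Lemma count_below_all L (X : {set 'I_L}) : count_below X L = #|X|.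
Proof. by rewrite /count_below; congr #|pred_of_set _|; apply/setP=> x;
  rewrite !inE ltn_ord andbT. Qed.

Lemma count_belowS L (X : {set 'I_L}) (z : 'I_L) : count_below X z.+1 = (count_below X z + (z \in
  X))%N.
Proof.
rewrite /count_below (cardsD1 z) !inE ltnSn andbT addnC; congr (_ + _)%N.
apply: eq_card => x; rewrite !inE ltnS (leq_eqVlt x) andbCA; congr (_ && _).
by case: (eqVneq x z) => [->|xz] /=; rewrite ?ltnn // (inj_eq val_inj) (negPf xz).
Qed.

Lemma count_belowD1 L (X : {set 'I_L}) (z : 'I_L) t : z \in X ->
  count_below X t = ((z < t) + count_below (X :\ z) t)%N.
Proof.
move=> zX; rewrite /count_below (cardsD1 z) !inE zX /=; congr (_ + _)%N.
by apply: eq_card => x; rewrite !inE andbA.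
Qed.

Lemma count_belowU1 L (X : {set 'I_L}) (z : 'I_L) t : z \notin X ->
  count_below (z |: X) t = ((z < t) + count_below X t)%N.
Proof. by move=> zX; rewrite (@count_belowD1 _ _ z) ?setU11 // setU1K. Qed.

Lemma sign_prod_lt L (X : {set 'I_L}) (z : nat) :
  \prod_(x in X) (if (x < z)%N then 1 else -1) = (-1) ^+ (#|X| + count_below X z) :> rat.
Proof.
rewrite (eq_bigr (fun x : 'I_L => (-1) ^+ (1 + (x < z))%N)); last first.
  by move=> x _; case: (x < z)%N; rewrite ?expr1 // sqrrN expr1n.
rewrite prodrXr big_split sum1_card /count_below -sum1dep_card; congr (_ ^+ (_ + _)).
by rewrite [RHS]big_mkcondr; apply: eq_bigr => x _; case: (_ < _)%N.
Qed.

Lemma root_poly_eval N (X : {set 'I_(2 * N).+1}) y :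
  (root_poly X).[y] = \prod_(x in X) (y - site N x).
Proof. by rewrite horner_prod; apply: eq_bigr => x _; rewrite hornerXsubC. Qed.

Lemma root_poly_mem N (X : {set 'I_(2 * N).+1}) (z : 'I_(2 * N).+1) :
  z \in X -> (root_poly X).[site N z] = 0.
Proof. by move=> zX; rewrite root_poly_eval (bigD1 z) //= subrr mul0r. Qed.

Lemma site_inj N : injective (fun z : 'I_(2 * N).+1 => site N z).
Proof. by move=> x y /addIr /eqP; rewrite eqr_nat => /eqP /val_inj. Qed.

Lemma root_poly_neq0 N (X : {set 'I_(2 * N).+1}) (z : 'I_(2 * N).+1) :
  z \notin X -> (root_poly X).[site N z] != 0.
Proof.
move=> zX; rewrite root_poly_eval; apply/prodf_neq0 => x xX.
by rewrite subr_eq0; apply: contraNneq zX => /site_inj->.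
Qed.

Lemma monic_root_poly N (X : {set 'I_(2 * N).+1}) : root_poly X \is monic.
Proof. by apply: monic_prod => x _; apply: monicXsubC. Qed.

Lemma size_root_poly N (X : {set 'I_(2 * N).+1}) : size (root_poly X) = #|X|.+1.
Proof.
by rewrite /root_poly -big_enum size_prod_XsubC cardE.
Qed.

(** The factor z - x has the wrong sign for each x in X above z; the exponent has the parity of the
    number of such x. *)
Lemma vdm_prod_setU1 N (X : {set 'I_(2 * N).+1}) (z : 'I_(2 * N).+1) : z \notin X ->
  vdm_prod (z |: X) = (-1) ^+ (#|X| + count_below X z) * (vdm_prod X * (root_poly X).[site N z]).
Proof.
move=> zX; rewrite -sign_prod_lt root_poly_eval.
pose g (i j : 'I_(2 * N).+1) : rat := if (i < j)%N then j%:R - i%:R else 1.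
have e1 : \prod_(j in z |: X) g z j = \prod_(j in X) g z j.
  by rewrite big_setU1 //= /g ltnn mul1r.
have e2 : \prod_(i in X) \prod_(j in z |: X) g i j = (\prod_(i in X) g i z) * vdm_prod X.
  by rewrite -big_split; apply: eq_bigr => i _; rewrite big_setU1.
rewrite {1}/vdm_prod big_setU1 //= -/(g _ _) e1 e2 mulrA [RHS]mulrCA mulrC; congr (_ * _).
rewrite -!big_split; apply: eq_bigr => i iX /=; rewrite /site /g.
case: (ltngtP i z) => [_|_|/val_inj ei].
- by ring.
- by ring.
- by rewrite -ei iX in zX.
Qed.

(** The sum is the coefficient of degree |V| - 1 in the Lagrange interpolant of g on V. The
    interpolant is g itself, whose degree is smaller. *)
Lemma lagrange_top_coef N (V : {set 'I_(2 * N).+1}) (g : {poly rat}) :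
  (size g < #|V|)%N ->
  \sum_(z in V) g.[site N z] / (root_poly (V :\ z)).[site N z] = 0.
Proof.
move=> sg.
pose P := \sum_(z in V) (g.[site N z] / (root_poly (V :\ z)).[site N z]) *: root_poly (V :\ z).
have sV z : z \in V -> size (root_poly (V :\ z)) = #|V|.
  by move=> zV; rewrite size_root_poly [RHS](cardsD1 z) zV.
have sP : (size P <= #|V|)%N.
  apply: leq_trans (size_sum _ _ _) _; apply/bigmax_leqP => z zV.
  by apply: leq_trans (size_scale_leq _ _) _; rewrite sV.
have eP z : z \in V -> P.[site N z] = g.[site N z].
  move=> zV; rewrite horner_sum (bigD1 z) //= hornerZ divfK; last first.
    by rewrite root_poly_neq0 // setD11.
  rewrite big1 ?addr0 // => x /andP[xV xz]; rewrite hornerZ (root_poly_mem (z := z)) ?mulr0 //.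
  by rewrite !inE eq_sym xz.
have PE : P = g.
  apply/eqP; rewrite -subr_eq0; apply: contraT => Pg.
  have := @max_poly_roots _ _ [seq site N z | z : 'I_(2 * N).+1 <- enum V] Pg.
  rewrite size_map -cardE map_inj_uniq ?enum_uniq; last exact: site_inj.
  have all_root : all (root (P - g)) [seq site N z | z : 'I_(2 * N).+1 <- enum V].
    apply/allP => y /mapP[z zV ->]; rewrite mem_enum in zV.
    by rewrite rootE hornerD hornerN eP // subrr.
  move=> /(_ all_root isT); rewrite ltnNge => /negP[].
  by apply: leq_trans (size_polyD _ _) _; rewrite size_polyN geq_max sP ltnW.
have P0 : P`_(#|V|.-1) = 0 by rewrite PE nth_default // -ltnS (ltn_predK sg).
rewrite -[RHS]P0 coef_sum; apply: eq_bigr => z zV; rewrite coefZ.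
have := monic_root_poly (V :\ z); rewrite monicE /lead_coef sV // => /eqP->.
by rewrite mulr1.
Qed.

(** By [vdm_prod_setU1], removing z from V divides the Vandermonde product by [root_poly (V :\ z)]
    at z up to sign, so this is the Lagrange identity times [vdm_prod V]. *)
Lemma alternating_vdm_prod_sum N (V : {set 'I_(2 * N).+1}) (g : {poly rat}) :
  (size g < #|V|)%N ->
  \sum_(z in V) (-1) ^+ count_below V z * g.[site N z] * vdm_prod (V :\ z) = 0.
Proof.
move=> /lagrange_top_coef H.
rewrite -[RHS](mulr0 ((-1) ^+ (#|V|.-1) * vdm_prod V)) -[X in _ = _ * X]H mulr_sumr;
  apply: eq_bigr => z zV.
have zV' : z \notin V :\ z by rewrite setD11.
have eV := vdm_prod_setU1 zV'; rewrite setD1K // in eV.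
rewrite eV (@count_belowD1 _ V z) // ltnn add0n (cardsD1 z V) zV /=.
have := root_poly_neq0 zV'; move: (root_poly _).[_] (vdm_prod _) g.[_] => c v h c0.
have sq : (-1) ^+ #|V :\ z| * (-1) ^+ #|V :\ z| = 1 :> rat by rewrite -exprD addnn -signr_odd
  odd_double.
rewrite add0n exprD.
transitivity (((-1) ^+ #|V :\ z| * (-1) ^+ #|V :\ z|) * ((-1) ^+ count_below (V :\ z) z * h * v)).
  by rewrite sq mul1r.
by field.
Qed.

(** Pairs of a set and one of its elements correspond to pairs of a smaller set and a point outside
    it. *)
Lemma sum_insert L m (F : 'I_L -> {set 'I_L} -> rat) :
  \sum_(W : {set 'I_L} | #|W| == m.+1) \sum_(z in W) F z (W :\ z)
  = \sum_(X : {set 'I_L} | #|X| == m) \sum_(z in ~: X) F z X.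
Proof.
rewrite !pair_big_dep /=.
rewrite (reindex_onto (fun p : {set 'I_L} * 'I_L => (p.2 |: p.1, p.2))
                      (fun p => (p.1 :\ p.2, p.2))) /=; last first.
  by case=> W z /= /andP[_ zW]; rewrite setD1K.
apply: eq_big => [[X z]|[X z]] /=.
  rewrite !inE eqxx andbT /= xpair_eqE eqxx andbT cardsU1.
  case zX: (z \in X) => /=; last by rewrite setU1K ?zX // eqxx andbT.
  rewrite andbF; apply/negP=> /andP[_ /eqP e].
  by have := setD11 z (z |: X); rewrite e zX.
by move=> /andP[_ /eqP[->]].
Qed.

(** Terms with z in X vanish because z is a root; the others are Vandermonde products of z |: X up
    to sign. *)
Lemma sum_root_poly_insert N a (s : {set 'I_(2 * N).+1} -> 'I_(2 * N).+1 -> rat) :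
  \sum_(X : {set 'I_(2 * N).+1} | #|X| == a)
     \sum_z s X z * (vdm_prod X * (root_poly X).[site N z])
  = \sum_(W : {set 'I_(2 * N).+1} | #|W| == a.+1)
     vdm_prod W * \sum_(z in W) s (W :\ z) z * (-1) ^+ (a + count_below W z).
Proof.
pose F z (X : {set 'I_(2 * N).+1}) := s X z * (vdm_prod X * (root_poly X).[site N z]).
transitivity (\sum_(X : {set 'I_(2 * N).+1} | #|X| == a) \sum_(z in ~: X) F z X).
  apply: eq_bigr => X _; rewrite (bigID (mem X)) /= big1 ?add0r.
    by apply: eq_bigl => z; rewrite inE.
  by move=> z zX; rewrite root_poly_mem // !mulr0.
rewrite -sum_insert; apply: eq_bigr => W /eqP cW; rewrite mulr_sumr.
apply: eq_bigr => z zW.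
have zW' : z \notin W :\ z by rewrite setD11.
have := vdm_prod_setU1 zW'; rewrite setD1K // => ->.
have -> : #|W :\ z| = a by have := cardsD1 z W; rewrite cW zW; lia.
rewrite (@count_belowD1 _ W z z) // ltnn add0n /F.
have sq : (-1) ^+ (a + count_below (W :\ z) z) * (-1) ^+ (a + count_below (W :\ z) z) = 1 :> rat.
  by rewrite -exprD addnn -signr_odd odd_double.
move: sq; set t := (-1) ^+ _ => sq.
rewrite -[LHS]mul1r -[X in X * _ = _]sq; ring.
Qed.

(** The sum is regrouped by V = z |: W. As s depends on V only, it leaves the inner sum, which
    vanishes by [alternating_vdm_prod_sum]. *)
Lemma sum_alternating N a (s : {set 'I_(2 * N).+1} -> rat) (g : {poly rat}) :
  (size g <= a)%N ->
  \sum_(W : {set 'I_(2 * N).+1} | #|W| == a)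
     vdm_prod W * \sum_(z in ~: W) s (z |: W) * (-1) ^+ count_below W z * g.[site N z] = 0.
Proof.
move=> sg.
pose F z (W : {set 'I_(2 * N).+1}) := vdm_prod W * (s (z |: W) * (-1) ^+ count_below W z * g.[site
  N z]).
transitivity (\sum_(W : {set 'I_(2 * N).+1} | #|W| == a) \sum_(z in ~: W) F z W).
  by apply: eq_bigr => W _; rewrite mulr_sumr.
rewrite -sum_insert big1 // => V /eqP cV.
rewrite -[RHS](mulr0 (s V)) -[X in _ = _ * X](@alternating_vdm_prod_sum _ V g) ?cV // mulr_sumr.
apply: eq_bigr => z zV; rewrite /F setD1K // (@count_belowD1 _ V z z) // ltnn add0n.
by ring.
Qed.

Definition vdm_sum (N a : nat) : rat :=
  \sum_(X : {set 'I_(2 * N).+1} | #|X| == a) vdm_prod X.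

(* Summation by parts: (-1) ^ #(W below z) changes sign exactly at the points of W, so
   that the increments involve H(z) - H(z - 1) off W and H(z) + H(z - 1) on W. *)
Lemma gap_step N (W : {set 'I_(2 * N).+1}) (H : rat -> rat) (z : 'I_(2 * N).+1) :
  let T i := (-1) ^+ count_below W i * H (site N i - 1) in
  T z.+1 - T z = (-1) ^+ count_below W z *
   (if z \in W then - (H (site N z) + H (site N z - 1)) else H (site N z) - H (site N z - 1)).
Proof.
move=> T; rewrite /T count_belowS.
have -> : site N z.+1 - 1 = site N z by rewrite /site -natr1; ring.
by case: (z \in W); rewrite ?addn0 ?addn1 ?exprS; ring.
Qed.

Lemma gap_sum N (W : {set 'I_(2 * N).+1}) (H : rat -> rat) :
  \sum_(z in ~: W) (-1) ^+ count_below W z * (H (site N z) - H (site N z - 1))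
  - \sum_(z in W) (-1) ^+ count_below W z * (H (site N z) + H (site N z - 1))
  = (-1) ^+ #|W| * H N%:R - H (- N%:R - 1).
Proof.
pose T i := (-1) ^+ count_below W i * H (site N i - 1).
have -> : (-1) ^+ #|W| * H N%:R - H (- N%:R - 1) = T (2 * N).+1 - T 0%N.
  rewrite /T count_below_all count_below0 expr0 mul1r /site; congr (_ * H _ - H _); last by ring.
  by rewrite -natr1 natrM; ring.
rewrite -(telescope_sumr T (leq0n _)) big_mkord [RHS](bigID (mem W)) /= [RHS]addrC -sumrN.
congr (_ + _).
  apply: eq_big => z; rewrite inE // => zW.
  by rewrite gap_step (negPf zW).
by apply: eq_bigr => z zW; rewrite gap_step zW mulrN.
Qed.

(* The extra sign change between - 1 and 0 produces the boundary term H(- 1). *)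
Lemma gap_sum_signed N (W : {set 'I_(2 * N).+1}) (H : rat -> rat) :
  let e (z : nat) := if (z < N)%N then -1 else 1 in
  \sum_(z in ~: W) e z * (-1) ^+ count_below W z * (H (site N z) - H (site N z - 1))
  - \sum_(z in W) e z * (-1) ^+ count_below W z * (H (site N z) + H (site N z - 1))
  = (-1) ^+ #|W| * H N%:R + H (- N%:R - 1) - 2 * (-1) ^+ count_below W N * H (- 1).
Proof.
move=> e; pose T i := (-1) ^+ count_below W i * H (site N i - 1).
have -> : (-1) ^+ #|W| * H N%:R + H (- N%:R - 1) - 2 * (-1) ^+ count_below W N * H (- 1)
        = - (T N - T 0%N) + (T (2 * N).+1 - T N).
  rewrite /T count_below_all count_below0 expr0 mul1r.
  rewrite (_ : site N N - 1 = - 1); last by rewrite /site; ring.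
  rewrite (_ : site N 0 - 1 = - N%:R - 1); last by rewrite /site; ring.
  rewrite (_ : site N (2 * N).+1 - 1 = N%:R); last first.
    by rewrite /site -natr1 natrM; ring.
  by ring.
rewrite -(telescope_sumr T (leq0n _)) -(telescope_sumr T (_ : (N <= (2 * N).+1)%N)); last by lia.
have -> : - \sum_(0 <= k < N) (T k.+1 - T k) = \sum_(0 <= k < N) e k * (T k.+1 - T k).
  rewrite -sumrN; apply: eq_big_nat => k /andP[_ kN].
  by rewrite /e kN mulN1r.
have -> : \sum_(N <= k < (2 * N).+1) (T k.+1 - T k)
        = \sum_(N <= k < (2 * N).+1) e k * (T k.+1 - T k).
  by apply: eq_big_nat => k /andP[Nk _]; rewrite /e ltnNge Nk mul1r.
rewrite -big_cat_nat //=; last by lia.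
rewrite big_mkord [RHS](bigID (mem W)) /= [RHS]addrC -sumrN; congr (_ + _).
  by apply: eq_big => z; rewrite inE // => zW; rewrite gap_step (negPf zW) mulrA.
by apply: eq_bigr => z zW; rewrite gap_step zW !mulrN mulrA.
Qed.

(** Pairing p_a with the monic [root_poly X] gives [cnorm N a], and [sum_root_poly_insert] makes
    this a signed sum of p_a over the points of sets W of size a+1. Summation by parts turns that
    into 2 H_a(N) plus a sum over the gaps of W, which vanishes after summation over W. *)
Lemma vdm_sum_rec N a : vdm_sum N a.+1 * (2 * (half_cheb N a).[N%:R]) = vdm_sum N a * cnorm N a.
Proof.
have := @sum_root_poly_insert N a (fun _ z => (cheb N a).[site N z]).
rewrite (eq_bigr (fun X => vdm_prod X * cnorm N a)); last first.
  move=> X /eqP cX.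
  rewrite -(@ssum_monic_cheb N a (root_poly X)) ?monic_root_poly ?size_root_poly ?cX //.
  by rewrite mulr_sumr; apply: eq_bigr => z _; ring.
rewrite -mulr_suml => ->.
pose g := half_cheb N a - (half_cheb N a \Po ('X - 1%:P)).
have gE y : g.[y] = (half_cheb N a).[y] - (half_cheb N a).[y - 1].
  by rewrite hornerD hornerN horner_comp hornerXsubC.
have sg : (size g <= a.+1)%N.
  apply: leq_trans (size_polyD _ _) _; rewrite size_polyN geq_max size_hcheb /=.
  by rewrite size_comp_poly2 ?size_XsubC // size_hcheb.
have := @sum_alternating N a.+1 (fun=> 1) g sg.
set S1 := \sum_(W | _) _ => S10.
have sq : (-1) ^+ a * (-1) ^+ a = 1 :> rat by rewrite -exprD addnn -signr_odd odd_double.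
(* With the vanishing sum subtracted, the identity holds for each W separately. *)
rewrite -[RHS]subr0 -[X in _ = _ - X](mulr0 ((-1) ^+ a)) -[X in _ = _ - _ * X]S10 /S1 /vdm_sum
  mulr_suml mulr_sumr -sumrB.
apply: eq_bigr => W /eqP cW.
have := gap_sum W (fun y => (half_cheb N a).[y]); rewrite cW.
have -> : (half_cheb N a).[- N%:R - 1] = (-1) ^+ a * (half_cheb N a).[N%:R].
  by rewrite -hcheb_sym; congr _.[_]; ring.
rewrite (eq_bigr (fun z : 'I__ => 1 * (-1) ^+ count_below W z * g.[site N z])); last first.
  by move=> z _; rewrite gE mul1r.
rewrite [X in _ - X = _](eq_bigr (fun z : 'I__ => (-1) ^+ a *
    ((cheb N a).[site N z] * (-1) ^+ (a + count_below W z)))); last first.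
  move=> z _; rewrite hcheb_avg exprD.
  by rewrite -[LHS]mul1r -[X in X * _ = _]sq; ring.
rewrite -mulr_sumr exprS => E.
rewrite [X in _ - X]mulrCA -mulrBr; congr (_ * _).
set A := \sum_(z in ~: W) _ in E *; set B := \sum_(z in W) _ in E *.
have -> : A = (-1) ^+ a * B + ((- 1 * (-1) ^+ a) * (half_cheb N a).[N%:R]
   - (-1) ^+ a * (half_cheb N a).[N%:R]) by rewrite -E; ring.
move: sq; set s := (-1) ^+ a => sq.
have -> : B - s * (s * B + (-1 * s * (half_cheb N a).[N%:R] - s * (half_cheb N a).[N%:R]))
  = B - (s * s) * B + 2 * ((s * s) * (half_cheb N a).[N%:R]) by ring.
rewrite sq; ring.
Qed.

(** The method of [vdm_sum_rec] with the kernel in place of p_a. The additional sign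
    (-1)^([count_below X N]) makes the sets containing the middle site count with sign +1. *)
Lemma vdm_sum_centered N n (o : 'I_(2 * N).+1) : (n <= N)%N -> o = N :> nat ->
  \sum_(X : {set 'I_(2 * N).+1} | (#|X| == (2 * n).+1) && (o \in X)) vdm_prod X
  = (kernel0 N n).[0] * vdm_sum N (2 * n).+1.
Proof.
move=> nN oN.
pose q := kernel0 N n; pose H := half_kernel0 N n.
(* The sign by which (-1)^([count_below V N]) changes when z enters or leaves V. *)
pose e (z : nat) : rat := if (z < N)%N then -1 else 1.
have site_o : site N o = 0 by rewrite /site oN subrr.
have sgn2 m : (-1) ^+ (2 * n + m) = (-1) ^+ m :> rat by rewrite exprD exprM sqrrN !expr1n mul1r.
have sq m : (-1) ^+ m * (-1) ^+ m = 1 :> rat by rewrite -exprD addnn -signr_odd odd_double.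
have rkD (W : {set 'I_(2 * N).+1}) (z : 'I_(2 * N).+1) : z \in W ->
    (-1) ^+ count_below (W :\ z) N = (-1) ^+ count_below W N * e z.
  move=> zW; rewrite (@count_belowD1 _ W z N) // exprD /e.
  by case: (z < N)%N; rewrite ?expr1 ?expr0; ring.
(* The indicator of o in W is written as a sum over W of a point mass at o; the two signs cancel at
   z = o. *)
transitivity (\sum_(W : {set 'I_(2 * N).+1} | #|W| == (2 * n).+1)
   vdm_prod W * \sum_(z in W) ((-1) ^+ count_below (W :\ z) N * (z == o)%:R) * (-1) ^+ (2 * n +
     count_below W z)).
  rewrite big_mkcondr; apply: eq_bigr => W _; case: ifP => oW; last first.
    rewrite big1 ?mulr0 // => z zW; case: eqP => [zo|]; last by rewrite mulr0 mul0r.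
    by rewrite -zo zW in oW.
  rewrite (bigD1 o) //= big1 ?addr0 => [|z /andP[_ /negPf->]]; last by rewrite mulr0 mul0r.
  by rewrite eqxx mulr1 sgn2 rkD // /e oN ltnn mulr1 sq mulr1.
rewrite -(@sum_root_poly_insert N (2 * n) (fun X z => (-1) ^+ count_below X N * (z == o)%:R)).
(* As [root_poly X] has degree 2n, its value at 0 is its sum against the kernel. *)
transitivity (\sum_(X : {set 'I_(2 * N).+1} | #|X| == (2 * n)%N)
   \sum_(z < (2 * N).+1) ((-1) ^+ count_below X N * q.[site N z]) * (vdm_prod X * (root_poly
     X).[site N z])).
  apply: eq_bigr => X /eqP cX.
  rewrite (bigD1 o) //= big1 ?addr0 => [|z /negPf->]; last by rewrite mulr0 mul0r.
  rewrite eqxx mulr1 site_o -(@kernel0_reproducing N n (root_poly X)) ?size_root_poly ?cX //.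
  by rewrite !mulr_sumr; apply: eq_bigr => z _; ring.
rewrite (@sum_root_poly_insert N (2 * n) (fun X z => (-1) ^+ count_below X N * q.[site N z])).
pose g := H - (H \Po ('X - 1%:P)).
have gE y : g.[y] = H.[y] - H.[y - 1].
  by rewrite hornerD hornerN horner_comp hornerXsubC.
have sg : (size g <= (2 * n).+1)%N.
  apply: leq_trans (size_polyD _ _) _; rewrite size_polyN geq_max size_khalf /=.
  by rewrite size_comp_poly2 ?size_XsubC // size_khalf.
have := @sum_alternating N (2 * n).+1 (fun V => (-1) ^+ count_below V N) g sg.
set S1 := \sum_(W | _) _ => S10.
rewrite -[LHS]subr0 -[X in _ - X = _]S10 /S1 /vdm_sum mulr_sumr -sumrB.
apply: eq_bigr => W /eqP cW; rewrite -mulrBr mulrC; congr (_ * _).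
have := gap_sum_signed W (fun y => H.[y]); rewrite cW /= -/e.
(* Since |W| is odd and H is symmetric about -1/2, the end terms cancel; the middle term stays, with
   2 H(-1) = H(0) + H(-1) = q(0). *)
have -> : H.[- N%:R - 1] = H.[N%:R] by rewrite -[RHS]khalf_sym; congr _.[_]; ring.
have q0 : 2 * H.[-1] = q.[0].
  by rewrite -khalf_avg sub0r -[in RHS](khalf_sym N n 0) subr0 -/H; ring.
rewrite (_ : 2 * (-1) ^+ count_below W N * H.[-1] = (-1) ^+ count_below W N * q.[0]);
  last by rewrite -q0; ring.
rewrite exprS (_ : (-1) ^+ (2 * n) = 1 :> rat); last by rewrite -[(2 * n)%N]addn0 sgn2.
rewrite mulr1 mulN1r addNr sub0r => E.
rewrite (eq_bigr (fun z : 'I__ => (-1) ^+ count_below W N *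
    (e z * (-1) ^+ count_below W z * (H.[site N z] + H.[site N z - 1])))); last first.
  by move=> z zW; rewrite sgn2 rkD // khalf_avg; ring.
rewrite [X in _ - X](eq_bigr (fun z : 'I__ => (-1) ^+ count_below W N *
    (e z * (-1) ^+ count_below W z * (H.[site N z] - H.[site N z - 1])))); last first.
  move=> z; rewrite inE => zW; rewrite count_belowU1 // exprD gE /e.
  by case: (z < N)%N; rewrite ?expr1 ?expr0; ring.
rewrite -!mulr_sumr -mulrBr -opprB E opprK mulrA sq mul1r.
by [].
Qed.

(** * Counting interlacing chains *)

Definition falling_poly (k : nat) : {poly rat} := \prod_(l < k) ('X - (l%:R)%:P).

Lemma fallp_eval k y : (falling_poly k).[y] = \prod_(l < k) (y - l%:R).
Proof. by rewrite horner_prod; apply: eq_bigr => l _; rewrite hornerXsubC. Qed.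

Lemma fallp_diff k y :
  (falling_poly k.+1).[y + 1] - (falling_poly k.+1).[y] = k.+1%:R * (falling_poly k).[y].
Proof.
rewrite !fallp_eval big_ord_recl [X in _ - X]big_ord_recr /= subr0.
rewrite (eq_bigr (fun l : 'I_k => y - l%:R)) => [|l _]; last first.
  by rewrite /bump /= add1n -natr1; ring.
rewrite (_ : k.+1%:R = k%:R + 1); last by rewrite natr1.
ring.
Qed.

Lemma size_fallp k : size (falling_poly k) = k.+1.
Proof. by rewrite /falling_poly -big_enum size_prod_XsubC -cardE card_ord. Qed.

Lemma monic_fallp k : falling_poly k \is monic.
Proof. by apply: monic_prod => l _; apply: monicXsubC. Qed.

(** Falling factorials are monic with degree equal to their index, so passing to them from the
    powers is a unitriangular change of columns in the Vandermonde matrix. *)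
Lemma det_fallp m (y : 'I_m -> rat) :
  \det (\matrix_(i < m, j < m) (falling_poly j).[y i])
  = \prod_(i < m) \prod_(j < m) (if (i < j)%N then y j - y i else 1).
Proof.
pose C := \matrix_(k < m, j < m) (falling_poly j)`_k.
have -> : \matrix_(i < m, j < m) (falling_poly j).[y i] = (Vandermonde m (\row_i y i))^T *m C.
  apply/matrixP => i j; rewrite !mxE.
  rewrite (@horner_coef_wide _ m); last by rewrite size_fallp.
  by apply: eq_bigr => k _; rewrite !mxE mulrC.
rewrite det_mulmx det_tr det_Vandermonde -[\det C]det_tr det_trig; last first.
  by apply/is_trig_mxP => i j ij; rewrite !mxE nth_default // size_fallp.
rewrite [X in _ * X]big1 => [|i _]; last first.
  by have := monic_fallp i; rewrite monicE /lead_coef size_fallp !mxE => /eqP.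
rewrite mulr1; apply: eq_bigr => i _; rewrite big_mkcond /=.
by apply: eq_bigr => j _; rewrite !mxE.
Qed.

(** Each row but the first has its predecessor subtracted, by the unitriangular U, and the
    determinant is expanded along the first column. *)
Lemma det_row_diff m (A : 'M[rat]_m.+1) : (forall i, A i ord0 = 1) ->
  \det A = \det (\matrix_(i < m, j < m)
     (A (lift ord0 i) (lift ord0 j) - A (widen_ord (leqnSn m) i) (lift ord0 j))).
Proof.
move=> A1.
pose U : 'M[rat]_m.+1 := \matrix_(i, j) ((i == j)%:R - (i == j.+1 :> nat)%:R).
have detU : \det U = 1.
  rewrite det_trig => [|]; last first.
    apply/is_trig_mxP => i j ij; rewrite mxE.
    by rewrite -val_eqE /= !ltn_eqF ?subr0 // ltnW.
  by rewrite big1 // => i _; rewrite mxE eqxx ltn_eqF ?subr0.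
have UA i j : (U *m A) i j = A i j - (if i == ord0 then 0 else A (inord i.-1) j).
  rewrite mxE (eq_bigr (fun k => (i == k)%:R * A k j - (i == k.+1 :> nat)%:R * A k j)); last first.
    by move=> k _; rewrite mxE mulrBl.
  rewrite sumrB; congr (_ - _).
    rewrite (bigD1 i) //= eqxx mul1r big1 ?addr0 // => k ki.
    by rewrite eq_sym (negPf ki) mul0r.
  case: eqP => [->|/eqP i0].
    by rewrite big1 // => k _; rewrite mul0r.
  have i0' : (0 < i)%N by rewrite lt0n.
  have ik : (i.-1 < m.+1)%N by have := ltn_ord i; lia.
  rewrite (bigD1 (inord i.-1)) //= big1 ?addr0; last first.
    move=> k ki; case: eqP => [ek|]; last by rewrite mul0r.
    by move: ki; rewrite ek /= inord_val eqxx.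
  by rewrite inordK // prednK // eqxx mul1r.
rewrite -[LHS]mul1r -detU -det_mulmx (expand_det_col _ ord0) (bigD1 ord0) //=.
rewrite UA eqxx subr0 A1 mul1r big1 ?addr0; last first.
  by move=> i i0; rewrite UA (negPf i0) !A1 subrr mul0r.
rewrite /cofactor /= addn0 expr0 mul1r; congr (\det _); apply/matrixP => i j.
rewrite [LHS]mxE [LHS]mxE UA [RHS]mxE; congr (_ - A _ _).
by apply: val_inj => /=; rewrite inordK //=; have := ltn_ord i; lia.
Qed.

(** After [det_row_diff], the factor j+1 is taken out of column j, which gives m!. By [sum_fallp]
    the remaining entries are sums of falling factorials over intervals. *)
Lemma det_fallp_rec m (x : nat -> nat) :
  \det (\matrix_(i < m.+1, j < m.+1) (falling_poly j).[(x i)%:R])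
  = m`!%:R * \det (\matrix_(i < m, j < m)
       (((falling_poly j.+1).[(x i.+1)%:R] - (falling_poly j.+1).[(x i)%:R]) / j.+1%:R)).
Proof.
rewrite det_row_diff => [|i]; last by rewrite mxE fallp_eval big_ord0.
set B := (X in _ = _ * \det X).
have -> : \matrix_(i < m, j < m)
    ((\matrix_(i, j) (falling_poly j).[(x i)%:R]) (lift ord0 i) (lift ord0 j)
     - (\matrix_(i < m.+1, j < m.+1) (falling_poly j).[(x i)%:R]) (widen_ord (leqnSn m) i) (lift
       ord0 j))
  = B *m diag_mx (\row_j j.+1%:R).
  apply/matrixP => i j; rewrite mul_mx_diag !mxE /= /bump /= !add1n.
  by rewrite divfK // pnatr_eq0.
rewrite det_mulmx det_diag mulrC fact_prod natr_prod big_add1 big_mkord /=.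
by congr (_ * _); apply: eq_bigr => i _; rewrite mxE.
Qed.

Lemma sum_fallp (u v k : nat) : (u <= v)%N ->
  \sum_(u <= y < v) (falling_poly k).[y%:R] = ((falling_poly k.+1).[v%:R] - (falling_poly
    k.+1).[u%:R]) / k.+1%:R.
Proof.
move=> uv; apply: (mulIf (_ : k.+1%:R != 0)); first by rewrite pnatr_eq0.
rewrite divfK ?pnatr_eq0 // -(telescope_sumr (fun y => (falling_poly k.+1).[y%:R]) uv) mulr_suml.
by apply: eq_bigr => y _; rewrite mulrC -fallp_diff natr1.
Qed.

Lemma sum_ord_interval L (u v : nat) (F : nat -> rat) : (v <= L)%N ->
  \sum_(y < L | (u <= y < v)%N) F y = \sum_(u <= y < v) F y.
Proof.
move=> vL; rewrite -(big_mkord (fun y => (u <= y < v)%N)).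
rewrite [RHS]big_nat [RHS](big_nat_widenl _ 0) //.
rewrite [RHS](big_nat_widen _ _ L) //.
by apply: eq_bigl => y; lia.
Qed.

(* Multilinearity of the determinant turns the sum over the box into a determinant of sums. *)
Lemma sum_box_det m L (x : nat -> nat) :
  (forall i, (i < m)%N -> (x i <= x i.+1 <= L)%N) ->
  m`!%:R * (\sum_(f in family (fun j : 'I_m => [pred y : 'I_L | (x j <= y < x j.+1)%N]))
     \prod_(i < m) \prod_(j < m) (if (i < j)%N then (f j)%:R - (f i)%:R else 1))
  = \prod_(i < m.+1) \prod_(j < m.+1) (if (i < j)%N then (x j)%:R - (x i)%:R else 1) :> rat.
Proof.
move=> xL.
rewrite -(det_fallp (fun i : 'I_m.+1 => (x i)%:R)) det_fallp_rec; congr (_ * _).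
rewrite (eq_bigr (fun f : {ffun 'I_m -> 'I_L} =>
   \sum_(s : {perm 'I_m}) (-1) ^+ s * \prod_(i < m) (falling_poly (s i)).[(f i)%:R])); last first.
  move=> f _; rewrite -(det_fallp (fun i : 'I_m => (f i)%:R)).
  by apply: eq_bigr => s _; congr (_ * _); apply: eq_bigr => i _; rewrite mxE.
rewrite exchange_big; apply: eq_bigr => s _ /=; rewrite -mulr_sumr; congr (_ * _).
rewrite -(bigA_distr_big_dep (fun (i : 'I_m) (y : 'I_L) => (x i <= y < x i.+1)%N)
  (fun (i : 'I_m) (y : 'I_L) => (falling_poly (s i)).[y%:R])).
apply: eq_bigr => i _; rewrite mxE.
have /andP[x1 x2] := xL i (ltn_ord i).
by rewrite (sum_ord_interval _ (fun y => (falling_poly (s i)).[y%:R])) // sum_fallp.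
Qed.

(** Encodes x_j <= y_j < x_(j+1) ([interlacesP]) through counting functions, the form in which a
    strip of a tiling provides it. *)
Definition interlaces (L : nat) (Y X : {set 'I_L}) : bool :=
  (#|X| == #|Y|.+1)
  && [forall t : 'I_L, (count_below X t.+1 <= (count_below Y t).+1)%N && (count_below Y t <=
    count_below X t)%N].

Definition nth_elt (L : nat) (X : {set 'I_L}) (i : nat) : nat :=
  nth 0%N [seq val z | z <- enum X] i.

Lemma nth_lt_count (s : seq nat) t i : sorted ltn s -> (i < size s)%N ->
  (i < count (fun z => z < t)%N s)%N = (nth 0%N s i < t)%N.
Proof.
elim: s i => [|x s IH] //= i px.
have ps : sorted ltn s by apply: path_sorted px.
have xs := allP (order_path_min ltn_trans px).
case: i => [_|i] /=.
  case: (ltnP x t) => // tx; rewrite add0n.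
  have /eqP -> // : count (fun z => z < t)%N s == 0%N.
  rewrite -leqn0 leqNgt -has_count; apply/hasPn => z /xs /= xz; rewrite -leqNgt.
  by apply: leq_trans tx (ltnW xz).
rewrite ltnS => si; rewrite -IH //; case: (ltnP x t) => tx; first by rewrite add1n ltnS.
have c0 : count (fun z => z < t)%N s = 0%N.
  apply/eqP; rewrite -leqn0 leqNgt -has_count; apply/hasPn => z /xs /= xz.
  by rewrite -leqNgt (leq_trans tx (ltnW xz)).
by rewrite c0.
Qed.

Lemma sorted_enum_set L (X : {set 'I_L}) : sorted ltn [seq val z | z <- enum X].
Proof.
rewrite sorted_map /enum_mem -enumT; apply: sorted_filter.
  by move=> x y z; exact: ltn_trans.
by rewrite -sorted_map val_enum_ord iota_ltn_sorted.
Qed.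

Lemma size_enum_set L (X : {set 'I_L}) : size [seq val z | z <- enum X] = #|X|.
Proof. by rewrite size_map -cardE. Qed.

Lemma lt_count_below L (X : {set 'I_L}) i t : (i < #|X|)%N -> (i < count_below X t)%N = (nth_elt X
  i < t)%N.
Proof.
move=> iX; rewrite /nth_elt -nth_lt_count ?sorted_enum_set ?size_enum_set //.
by rewrite count_map -sum1_count big_enum_cond /count_below -sum1dep_card.
Qed.

Lemma nth_elt_lt L (X : {set 'I_L}) i j : (i < j < #|X|)%N -> (nth_elt X i < nth_elt X j)%N.
Proof.
case/andP=> ij jX; apply: (sorted_ltn_nth ltn_trans 0%N (sorted_enum_set X));
  rewrite ?inE ?size_enum_set //; exact: ltn_trans jX.
Qed.

Lemma nth_elt_bound L (X : {set 'I_L}) i : (i < #|X|)%N -> (nth_elt X i < L)%N.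
Proof. by move=> iX; rewrite -lt_count_below // count_below_all. Qed.

Lemma count_below_le L (X : {set 'I_L}) t : (count_below X t <= #|X|)%N.
Proof. by apply: subset_leq_card; apply/subsetP => x; rewrite inE => /andP[]. Qed.

Lemma interlacesP L (Y X : {set 'I_L}) :
  reflect (#|X| = #|Y|.+1 /\
           forall j, (j < #|Y|)%N -> (nth_elt X j <= nth_elt Y j < nth_elt X j.+1)%N)
          (interlaces Y X).
Proof.
apply: (iffP andP) => [[/eqP c /forallP H]|[c H]]; split=> //.
- move=> j jY; have yL := nth_elt_bound jY.
  have /andP[H1 _] := H (Ordinal yL); rewrite /= in H1.
  have rY : count_below Y (nth_elt Y j) = j.
    apply/eqP; rewrite eqn_leq; apply/andP; split.
      rewrite leqNgt; apply/negP => jr.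
      by have := lt_count_below (nth_elt Y j) jY; rewrite jr ltnn.
    case: j jY {yL H1} => // j jY; rewrite lt_count_below ?nth_elt_lt ?ltnSn //; exact: ltnW.
  rewrite rY in H1.
  apply/andP; split; last first.
    rewrite ltnNge; apply/negP => xy.
    have : (j.+1 < count_below X (nth_elt Y j).+1)%N by rewrite lt_count_below ?c ?ltnS.
    by rewrite ltnNge H1.
  rewrite -ltnS -lt_count_below; last by rewrite c ltnS ltnW.
  have : (j < count_below Y (nth_elt Y j).+1)%N by rewrite lt_count_below.
  (* When y_j is the last position, y_j + 1 is not an index in 'I_L, but the counts there are the
     full cardinalities. *)
  case: (ltnP (nth_elt Y j).+1 L) => [sL|sL].
    by have /andP[_ /= H2] := H (Ordinal sL); move/leq_trans; apply.
  have -> : (nth_elt Y j).+1 = L by apply/eqP; rewrite eqn_leq sL yL.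
  by rewrite !count_below_all c => /leqW.
- exact/eqP.
apply/forallP => t; apply/andP; split.
  rewrite leqNgt; apply/negP => h.
  have h2 := leq_trans h (count_below_le X _); rewrite c ltnS in h2.
  rewrite lt_count_below in h; last by rewrite c ltnS.
  have /andP[_ h3] := H _ h2.
  have : (nth_elt Y (count_below Y t) < t)%N by rewrite ltnS in h; exact: leq_trans h3 h.
  by rewrite -lt_count_below // ltnn.
rewrite leqNgt; apply/negP => h.
have h2 := leq_trans h (count_below_le Y _).
have /andP[h3 _] := H _ h2.
rewrite lt_count_below // in h.
have : (nth_elt X (count_below X t) < t)%N by exact: leq_ltn_trans h3 h.
by rewrite -lt_count_below ?ltnn // c ltnS ltnW.
Qed.

Definition image_set (L m : nat) (f : {ffun 'I_m -> 'I_L}) : {set 'I_L} := [set f j | j : 'I_m].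

Definition enum_fun (L m : nat) (X : {set 'I_L.+1}) : {ffun 'I_m -> 'I_L.+1} :=
  [ffun j : 'I_m => inord (nth_elt X j)].

Lemma nth_elt_image L m (f : {ffun 'I_m -> 'I_L}) :
  (forall i j : 'I_m, (i < j)%N -> (f i < f j)%N) ->
  #|image_set f| = m /\ forall j : 'I_m, nth_elt (image_set f) j = f j.
Proof.
move=> fi.
have finj : injective f.
  move=> i j e; apply/val_inj/eqP; case: ltngtP => // /fi; by rewrite e ltnn.
have c : #|image_set f| = m by rewrite card_imset // card_ord.
split=> // j.
have E : [seq val z | z <- enum (image_set f)] = [seq val (f i) | i <- enum 'I_m].
  apply: (irr_sorted_eq ltn_trans ltnn); first exact: sorted_enum_set.
    rewrite sorted_map; apply: (@sub_sorted _ (relpre val ltn)) => [i k|]; first exact: fi.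
    by rewrite -sorted_map val_enum_ord iota_ltn_sorted.
  move=> z; apply/mapP/mapP => [[y]|[i _ ->]].
    by rewrite mem_enum => /imsetP[i _ ->] ->; exists i => //; rewrite mem_enum.
  by exists (f i) => //; rewrite mem_enum imset_f.
rewrite /nth_elt E (nth_map j) ?size_enum_ord //.
by rewrite nth_ord_enum.
Qed.

Lemma enum_funE L m (X : {set 'I_L.+1}) (j : 'I_m) : #|X| = m -> enum_fun m X j = nth_elt X j :>
  nat.
Proof. by move=> c; rewrite ffunE inordK // nth_elt_bound // c. Qed.

Lemma image_set_enum_fun L m (X : {set 'I_L.+1}) : #|X| = m -> image_set (enum_fun m X) = X.
Proof.
move=> c; apply/eqP; rewrite eqEcard.
have fi (i j : 'I_m) : (i < j)%N -> (enum_fun m X i < enum_fun m X j)%N.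
  by move=> ij; rewrite !enum_funE // nth_elt_lt // ij c ltn_ord.
have [-> _] := nth_elt_image fi; rewrite c leqnn andbT.
apply/subsetP => y /imsetP[j _ ->].
have : nth_elt X j \in [seq val z | z <- enum X] by rewrite mem_nth // size_enum_set c.
move=> /mapP[z]; rewrite mem_enum => zX ez.
by rewrite (_ : enum_fun m X j = z) //; apply: val_inj; rewrite /= enum_funE.
Qed.

Lemma vdm_prod_image L m (f : {ffun 'I_m -> 'I_L}) : injective f ->
  (forall i j : 'I_m, (i < j)%N = (f i < f j)%N) ->
  vdm_prod (image_set f) = \prod_(i < m) \prod_(j < m) (if (i < j)%N then (f j)%:R - (f i)%:R else
    1).
Proof.
move=> finj fi; rewrite /vdm_prod /image_set big_imset /=; last by move=> i j _ _; exact: finj.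
apply: eq_bigr => i _; rewrite big_imset /=; last by move=> j k _ _; exact: finj.
by apply: eq_bigr => j _; rewrite fi.
Qed.

Lemma incr_inj L m (f : {ffun 'I_m -> 'I_L}) :
  (forall i j : 'I_m, (i < j)%N -> (f i < f j)%N) ->
  injective f /\ forall i j : 'I_m, (i < j)%N = (f i < f j)%N.
Proof.
move=> fi; split=> [i j e|i j].
  by apply/val_inj/eqP; case: ltngtP => // /fi; rewrite e ltnn.
apply/idP/idP => [/fi //|]; apply: contraLR; rewrite -!leqNgt leq_eqVlt.
by case/orP => [/eqP/val_inj->//|/fi /ltnW].
Qed.

Lemma vdm_prod_elt L m (X : {set 'I_L.+1}) : #|X| = m ->
  vdm_prod X = \prod_(i < m) \prod_(j < m) (if (i < j)%N then (nth_elt X j)%:R - (nth_elt X i)%:R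
    else 1).
Proof.
move=> c; rewrite -{1}(image_set_enum_fun c).
have fi (i j : 'I_m) : (i < j)%N -> (enum_fun m X i < enum_fun m X j)%N.
  by move=> ij; rewrite !enum_funE // nth_elt_lt // ij c ltn_ord.
have [finj fi'] := incr_inj fi.
rewrite vdm_prod_image //; apply: eq_bigr => i _; apply: eq_bigr => j _.
by rewrite !enum_funE.
Qed.

(** Sets interlacing X are the points of the box of intervals [x_j, x_(j+1)); these intervals are
    consecutive, so each such point is an increasing sequence and determines its set. *)
Lemma sum_interlacing L m (X : {set 'I_L.+1}) : #|X| = m.+1 ->
  m`!%:R * (\sum_(Y : {set 'I_L.+1} | interlaces Y X) vdm_prod Y) = vdm_prod X.
Proof.
move=> cX; rewrite (vdm_prod_elt cX) -(@sum_box_det m L.+1 (nth_elt X)); last first.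
  move=> i im; rewrite ltnW ?nth_elt_lt ?ltnSn ?cX ?ltnS //=.
  by rewrite ltnW // nth_elt_bound // cX ltnS.
congr (_ * _).
rewrite (reindex_onto (@image_set L.+1 m) (enum_fun m)) /=; last first.
  by move=> Y /interlacesP[c _]; rewrite image_set_enum_fun //; move: c; rewrite cX => -[].
have box_incr (f : {ffun 'I_m -> 'I_L.+1}) :
    f \in family (fun j : 'I_m => [pred y : 'I_L.+1 | (nth_elt X j <= y < nth_elt X j.+1)%N]) ->
    forall i j : 'I_m, (i < j)%N -> (f i < f j)%N.
  move=> /familyP H i j ij.
  have := H i; have := H j; rewrite !inE => /andP[h1 _] /andP[_ h2].
  apply: leq_trans h2 (leq_trans _ h1).
  by case: (ltngtP i.+1 j) ij => // [ij _|-> //];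
    rewrite ltnW // nth_elt_lt // ij cX ltnW // ltnS ltn_ord.
apply: eq_big => [f|f].
  apply/andP/idP => [[/interlacesP[c H] /eqP e]|fF].
    have c' : #|image_set f| = m by move: c; rewrite cX => -[].
    apply/familyP => j; rewrite inE -e enum_funE // H // c' //.
  have fi := box_incr f fF; have [c fE] := nth_elt_image fi.
  split; last by apply/eqP/ffunP => j; apply: val_inj; rewrite /= enum_funE // fE.
  apply/interlacesP; rewrite c cX; split=> // j jm.
  by have /familyP/(_ (Ordinal jm)) := fF; rewrite inE -(fE (Ordinal jm)).
case/andP => /interlacesP[c H] /eqP e.
have c' : #|image_set f| = m by move: c; rewrite cX => -[].
have fi (i j : 'I_m) : (i < j)%N -> (f i < f j)%N.
  by move=> ij; rewrite -e !enum_funE // nth_elt_lt // ij c' ltn_ord.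
by have [finj fi'] := incr_inj fi; exact: vdm_prod_image.
Qed.

(** The empty X_0 is left implicit: the tuple lists X_1, ..., X_m. *)
Definition chains (L m : nat) (X : {set 'I_L}) : {set m.-tuple {set 'I_L}} :=
  [set s : m.-tuple {set 'I_L} | path (@interlaces L) set0 s & last set0 s == X].

Lemma card_chainsS L m (X : {set 'I_L}) :
  #|chains m.+1 X| = (\sum_(Y : {set 'I_L} | interlaces Y X) #|chains m Y|)%N.
Proof.
have -> : chains m.+1 X
  = (fun s : m.-tuple {set 'I_L} => [tuple of rcons s X]) @:
    [set s : m.-tuple {set 'I_L} | path (@interlaces L) set0 s & interlaces (last set0 s) X].
  apply/setP => s; apply/idP/imsetP => [|[s' + ->]]; last first.
    by rewrite !inE rcons_path last_rcons eqxx andbT.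
  case/tupleP: s => x s; rewrite inE => /andP[p /eqP l].
  have sz : size (belast x s) == m by rewrite size_belast size_tuple.
  have es : x :: s = rcons (belast x s) X by rewrite lastI; congr rcons; exact: l.
  exists (Tuple sz); last by apply: val_inj; rewrite /= es.
  by rewrite inE /= -rcons_path -es.
rewrite card_in_imset => [|s1 s2 _ _ /(congr1 val) /= /rcons_inj[] /val_inj //].
rewrite -sum1_card (partition_big (fun s : m.-tuple {set 'I_L} => last set0 s)
  (fun Y => interlaces Y X)) /=; last by move=> s; rewrite inE => /andP[].
apply: eq_bigr => Y YX; rewrite sum1dep_card; apply: eq_card => s; rewrite !inE -andbA.
by case: eqP => [->|]; rewrite ?YX ?andbF.
Qed.

(** Induction on m: deleting the last set and applying [sum_interlacing] costs one factor m!. *)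
Lemma card_chains L m (X : {set 'I_L.+1}) :
  #|chains m X|%:R * (\prod_(i < m) i`!)%:R = (if #|X| == m then vdm_prod X else 0) :> rat.
Proof.
elim: m X => [|m IH] X.
  rewrite big_ord0 mulr1 cards_eq0 eq_sym; case: eqP => [<-|/eqP X0].
    rewrite /vdm_prod big_set0 (_ : chains 0 set0 = setT) ?cardsT ?card_tuple ?expn0 //.
    by apply/setP => s; rewrite !inE tuple0 /= eqxx.
  rewrite (_ : chains 0 X = set0) ?cards0 //.
  by apply/setP => s; rewrite !inE tuple0 /= (negPf X0).
rewrite card_chainsS natr_sum big_ord_recr /= natrM mulrA mulr_suml.
rewrite (eq_bigr (fun Y : {set 'I_L.+1} => if #|Y| == m then vdm_prod Y else 0)) => [|Y _];
  last exact: IH.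
case: (eqVneq #|X| m.+1) => cX.
  rewrite -(sum_interlacing cX) mulrC; congr (_ * _).
  apply: eq_bigr => Y /interlacesP[c _]; move: c; rewrite cX => -[<-].
  by rewrite eqxx.
rewrite big1 ?mul0r // => Y /interlacesP[c _]; case: eqP => // cY.
by rewrite c cY eqxx in cX.
Qed.

Local Close Scope ring_scope.

(** * Tilings and interlacing chains *)

(* The strip of the left half that is the strip k or its mirror image. *)
Definition left_strip (a k : nat) : nat := minn k (2 * a - 1 - k).

Lemma in_hexE a b k y : in_hex a b a (k, y)
  = (k < 2 * a) && (a - left_strip a k <= y <= a + 2 * b + left_strip a k).
Proof.
rewrite /in_hex /lo /hi /left_strip /=.
by case: (ltnP k a) => ka; apply/idP/idP => H; lia.
Qed.

(** Directed form of [has_tile]: [adj] fixes the order of the two triangles of a rhombus, and the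
    tiling is recovered from this relation on coordinates. *)
Definition has_pair (M : nat) (S : {set Tri M * Tri M}) (p q : tri) : bool :=
  [exists r in S, (tv r.1 == p) && (tv r.2 == q)].

Lemma tv_inj M : injective (@tv M).
Proof. by move=> [x y] [x' y'] [/val_inj-> /val_inj->]. Qed.

Lemma has_pair_mem M (S : {set Tri M * Tri M}) r : r \in S -> has_pair S (tv r.1) (tv r.2).
Proof. by move=> rS; apply/existsP; exists r; rewrite rS !eqxx. Qed.

Lemma has_pairE M (S : {set Tri M * Tri M}) r : has_pair S (tv r.1) (tv r.2) = (r \in S).
Proof.
apply/idP/idP => [/existsP[[r1 r2] /and3P[rS /eqP/tv_inj e1 /eqP/tv_inj e2]]|];
  last exact: has_pair_mem.
by case: r e1 e2 => [u v] /= <- <-.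
Qed.

Lemma has_pair_sum M (S : {set Tri M * Tri M}) p q :
  \sum_(r in S) ((tv r.1 == p) && (tv r.2 == q)) = has_pair S p q :> nat.
Proof.
case E: (has_pair S p q); last first.
  rewrite big1 // => r rS; case H: (_ && _) => //.
  by move/existsP: E => []; exists r; rewrite rS H.
move/existsP: E => [r0 /and3P[r0S /eqP e1 /eqP e2]].
rewrite (bigD1 r0) //= e1 e2 !eqxx big1 // => r /andP[_ rr0].
case: eqP => //= h1; case: eqP => //= h2; case/eqP: rr0.
by case: r r0 e1 e2 h1 h2 {r0S} => [u v] [u0 v0] /= <- <- /tv_inj-> /tv_inj->.
Qed.

(* Number of pairs covering the triangle (k, y).  At k = 0 or y = 0 the truncated
   predecessors give the pair of (k, y) with itself, which is never adjacent. *)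
Definition cover_count (h : tri -> tri -> bool) (k y : nat) : nat :=
  h (k, y) (k, y.+1) + h (k, y.-1) (k, y) + h (k, y) (k.+1, y) + h (k.-1, y) (k, y).

(** For an adjacent pair the four cases of [cover_count] are mutually exclusive, so each covering
    pair is counted once. *)
Lemma card_cover a M (S : {set Tri M * Tri M}) (t : Tri M) :
  (forall r, r \in S -> adj a (tv r.1) (tv r.2)) -> 0 < t.2 ->
  #|[set r in S | (r.1 == t) || (r.2 == t)]| = cover_count (has_pair S) t.1 t.2.
Proof.
move=> Sadj t2; rewrite /cover_count -!has_pair_sum -!big_split /= -sum1dep_card big_mkcondr /=.
apply: eq_bigr => r /Sadj; rewrite -!(inj_eq (@tv_inj M)).
case: r t t2 => [[x1 y1] [x2 y2]] [x y] /=.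
rewrite /adj /tv /= !xpair_eqE.
case: y => [[|y] yM] //= _; case: x => [x xM] /=.
move: (nat_of_ord x1) (nat_of_ord x2) (nat_of_ord y1) (nat_of_ord y2).
move=> {x1 x2 y1 y2} x1 x2 y1 y2.
case/orP => [/andP[/eqP-> /eqP->]|/and3P[_ /eqP-> /eqP->]]; rewrite !eqSS.
  case: (eqVneq x1 x) => [->|_] /=; last by rewrite !andbF.
  rewrite (ltn_eqF (ltnSn x)) !andbF addn0.
  case: (eqVneq y1 y) => [->|_]; last first.
    by rewrite !andbF; case: (y1 == y.+1).
  by rewrite (ltn_eqF (ltnSn y)) !andbF.
case: (eqVneq y1 y.+1) => [->|_]; last by rewrite !andbF.
rewrite (gtn_eqF (ltnSn y)) !andbF !andbT /= eqSS.
case: (eqVneq x1 x) => [->|_] /=.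
  by rewrite (gtn_eqF (ltnSn x)) /= andbF.
case: x {xM} => [|x] /=; first by rewrite andbF.
by rewrite eqSS andbb; case: (x1 == x).
Qed.

Definition perfect_matching (a b : nat) (h : tri -> tri -> bool) : Prop :=
  (forall p q, h p q -> [/\ in_hex a b a p, in_hex a b a q & adj a p q])
  /\ (forall k y, in_hex a b a (k, y) -> cover_count h k y = 1).

Lemma is_tilingP a b (S : {set Tri (bnd a b a) * Tri (bnd a b a)}) :
  is_tiling a b a S <-> perfect_matching a b (has_pair S).
Proof.
set M := bnd a b a in S *; set hex := in_hex a b a.
have hex0 k y : hex (k, y) -> 0 < y by rewrite /hex in_hexE /left_strip; lia.
have hexM k y : hex (k, y) -> k < M /\ y < M by rewrite /hex in_hexE /left_strip /M /bnd; lia.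
split=> [/andP[/forallP H1 /forallP H2]|[H1 H2]].
  have H1' r : r \in S -> [/\ hex (tv r.1), hex (tv r.2) & adj a (tv r.1) (tv r.2)].
    by move=> rS; have /implyP/(_ rS)/and3P := H1 r.
  split=> [p q /existsP[r /and3P[rS /eqP<- /eqP<-]]|k y ky]; first exact: H1'.
  have [kM yM] := hexM _ _ ky.
  have := @card_cover a M S (Ordinal kM, Ordinal yM); rewrite /= => <-.
  - by have /implyP := H2 (Ordinal kM, Ordinal yM); rewrite /tv /= => /(_ ky) /eqP.
  - by move=> r /H1'[].
  - exact: hex0 ky.
have H1' r : r \in S -> [/\ hex (tv r.1), hex (tv r.2) & adj a (tv r.1) (tv r.2)].
  by move=> /has_pair_mem /H1.
apply/andP; split; apply/forallP.
  by move=> r; apply/implyP => /H1'/and3P.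
move=> t; apply/implyP => ht; rewrite (@card_cover a).
- by rewrite (H2 t.1 t.2).
- by move=> r /H1'[].
- exact: hex0 ht.
Qed.

(* Positions of the rhombi crossing line k; position i on line k1 + 1 is at doubled
   height a - k1 + 2 i, and is the base of the left-pointing triangle of offset 2 i in
   strip k1. *)
Definition crossings (L a : nat) (h : tri -> tri -> bool) (k : nat) : {set 'I_L} :=
  if k is k1.+1 then [set i : 'I_L | h (k1, a - k1 + 2 * i) (k1.+1, a - k1 + 2 * i)]
  else set0.

Lemma matching_adjF a b h p q : perfect_matching a b h -> adj a p q = false -> h p q = false.
Proof. by move=> [H _] apq; apply/negP => /H[_ _]; rewrite apq. Qed.

Lemma matching_hexF1 a b h p q : perfect_matching a b h -> in_hex a b a p = false -> h p q = false.
Proof. by move=> [H _] hp; apply/negP => /H[]; rewrite hp. Qed.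

Lemma matching_hexF2 a b h p q : perfect_matching a b h -> in_hex a b a q = false -> h p q = false.
Proof. by move=> [H _] hq; apply/negP => /H[_]; rewrite hq. Qed.

Lemma crossings_supp L a b h k (i : 'I_L) : perfect_matching a b h -> k <= a ->
  i \in crossings L a h k -> i < b + k.
Proof.
move=> g; case: k => [|k] ka; rewrite /= inE // => H.
case: g => /(_ _ _ H) [+ _ _] _; rewrite in_hexE /left_strip; lia.
Qed.

(** Even offsets are left-pointing triangles: the partner lies above, below, or across line k+1. *)
Lemma left_sum_even L a b h k t (tL : t < L) : perfect_matching a b h -> k < a -> t <= b + k ->
  h (k, a - k + 2 * t) (k, (a - k + 2 * t).+1)
  + h (k, (a - k + 2 * t).-1) (k, a - k + 2 * t)
  + (Ordinal tL \in crossings L a h k.+1) = 1.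
Proof.
move=> g ka tb; rewrite inE /=.
have G : cover_count h k (a - k + 2 * t) = 1 by apply: g.2; rewrite in_hexE /left_strip; lia.
rewrite -[RHS]G /cover_count.
have F : h (k.-1, a - k + 2 * t) (k, a - k + 2 * t) = false.
  by apply: (matching_adjF g); rewrite /adj /left_pointing /=; apply/negbTE/negP; lia.
by rewrite F addn0.
Qed.

(** Odd offsets are right-pointing triangles: the partner lies above, below, or across line k. *)
Lemma left_sum_odd L a b h k t (tL : t < L) : perfect_matching a b h -> k < a -> t < b + k ->
  h (k, (a - k + 2 * t).+1) (k, (a - k + 2 * t).+2)
  + h (k, a - k + 2 * t) (k, (a - k + 2 * t).+1)
  + (Ordinal tL \in crossings L a h k) = 1.
Proof.
move=> g ka tb.
have G : cover_count h k (a - k + 2 * t).+1 = 1 by apply: g.2; rewrite in_hexE /left_strip; lia.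
rewrite -[RHS]G /cover_count.
have F : h (k, (a - k + 2 * t).+1) (k.+1, (a - k + 2 * t).+1) = false.
  by apply: (matching_adjF g); rewrite /adj /left_pointing /=; apply/negbTE/negP; lia.
rewrite F addn0 /=.
congr (_ + nat_of_bool _); case: k ka tb {G F} => [|k] ka tb /=.
  by rewrite inE; apply/esym/(matching_adjF g); rewrite /adj /=; apply/negbTE/negP; lia.
rewrite inE /=; have -> : a - k + 2 * t = (a - k.+1 + 2 * t).+1 by lia.
by [].
Qed.

(** The two local equations summed from the bottom of the strip. Offsets 0, ..., 2t contain one more
    left-pointing than right-pointing triangle; offsets 0, ..., 2t+1 contain equally many. *)
Lemma crossings_count_eq L a b h k t : L = a + b -> perfect_matching a b h -> k < a -> t <= b + k ->
  count_below (crossings L a h k.+1) t.+1 + h (k, a - k + 2 * t) (k, (a - k + 2 * t).+1)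
    = (count_below (crossings L a h k) t).+1
  /\ (t < b + k ->
      count_below (crossings L a h k.+1) t.+1 = count_below (crossings L a h k) t.+1
        + h (k, (a - k + 2 * t).+1) (k, (a - k + 2 * t).+2)).
Proof.
move=> LE g ka; elim: t => [|t IH] tb.
  have L0 : 0 < L by lia.
  have E0 := left_sum_even L0 g ka tb.
  rewrite (matching_hexF1 _ g (p := (k, (a - k + 2 * 0).-1))) in E0; last first.
    by rewrite in_hexE /left_strip; apply/negbTE/negP; lia.
  have r1 (X : {set 'I_L}) := count_belowS X (Ordinal L0); rewrite /= in r1.
  rewrite !r1 !count_below0; split; first by move: E0; case: (h _ _); case: (_ \in _).
  move=> tb'; have := left_sum_odd L0 g ka tb'; move: E0.
  move: (h (_, a - k + _) _) (h (_, (a - k + _).+1) _) => u v.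
  by case: (_ \in _); case: (_ \in _); case: u; case: v.
have tL : t.+1 < L by lia.
have tL' : t < L by lia.
have [IH1 IH2] := IH (ltnW tb); have IH3 := IH2 tb.
have r1 (X : {set 'I_L}) := count_belowS X (Ordinal tL); rewrite /= in r1.
have E0 := left_sum_even tL g ka tb.
have e2 : a - k + 2 * t.+1 = (a - k + 2 * t).+2 by lia.
have O0 := left_sum_odd tL g ka; rewrite e2 in O0.
have E1 : ((a - k + 2 * t).+2.-1 = (a - k + 2 * t).+1) by [].
rewrite e2 E1 in E0; rewrite !r1 IH3 e2 {IH IH1 IH2 IH3 r1 E1}.
set y := a - k + 2 * t in E0 O0 *.
set u := h (k, y.+1) _ in E0 *; set v := h (k, y.+2) _ in E0 O0 *; set w := h (k, y.+3) _ in O0 *.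
move: u v w E0 O0 => u v w.
move: (count_below _ _) (Ordinal tL \in _) (Ordinal tL \in _) => r x z E0 O0.
by split=> [|/O0]; lia.
Qed.

Lemma count_below_supp L (X : {set 'I_L}) m t : (forall i, i \in X -> i < m) -> m <= t ->
  count_below X t = #|X|.
Proof.
move=> H mt; apply: eq_card => i; rewrite !inE; case iX: (i \in X) => //=.
by apply: leq_trans mt; apply: H.
Qed.

(** In [crossings_count_eq] the rhombus term is 0 or 1, which gives the inequalities. At the top of
    the strip no rhombus leaves upwards, which gives the cardinality. *)
Lemma matching_interlaces L a b h k : L = a + b -> perfect_matching a b h -> k < a ->
  interlaces (crossings L a h k) (crossings L a h k.+1).
Proof.
move=> LE g ka.
have s0 := fun i => @crossings_supp L a b h k i g (ltnW ka).
have s1 := fun i => @crossings_supp L a b h k.+1 i g ka.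
have H t tb := @crossings_count_eq L a b h k t LE g ka tb.
have c : #|crossings L a h k.+1| = #|crossings L a h k|.+1.
  have [+ _] := H (b + k) (leqnn _).
  rewrite (count_below_supp s1) ?addnS // (count_below_supp s0) //.
  rewrite (matching_hexF2 _ g) ?addn0 //.
  by rewrite in_hexE /left_strip; apply/negbTE/negP; lia.
apply/andP; split; first by rewrite c.
apply/forallP => t; apply/andP; split.
  case: (leqP t (b + k)) => tb; first by have [+ _] := H t tb; lia.
  by rewrite (count_below_supp s1) ?(count_below_supp s0) ?c //; lia.
case: t => [[|t] tL] /=; first by rewrite count_below0.
case: (ltnP t (b + k)) => tb; first by have [_ /(_ tb) ->] := H t (ltnW tb); lia.
by rewrite (count_below_supp s1) ?(count_below_supp s0) ?c //; lia.
Qed.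

(* Whether the triangles at offsets o and o + 1 of a strip form a rhombus, where X and Y
   are the crossings of the right and left boundary lines of the strip: the
   surplus of left-pointing over right-pointing triangles up to offset o is accounted for
   by the crossings and by the rhombus that leaves this range upwards. *)
Definition chain_vert (L : nat) (X Y : {set 'I_L}) (o : nat) : bool :=
  if odd o then count_below X o./2.+1 != count_below Y o./2.+1 else count_below X o./2.+1 ==
    count_below Y o./2.

Lemma matching_vert L a b h k o : L = a + b -> perfect_matching a b h -> k < a -> o <= 2 * (b + k)
  ->
  h (k, a - k + o) (k, (a - k + o).+1) = chain_vert (crossings L a h k.+1) (crossings L a h k) o.
Proof.
move=> LE g ka ob; rewrite /chain_vert.
case: ifP => oo.
  have eo : o = (2 * o./2).+1 by have := odd_double_half o; rewrite oo; lia.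
  have tb : o./2 <= b + k by lia.
  have [_ H] := crossings_count_eq LE g ka tb.
  have -> : a - k + o = (a - k + 2 * o./2).+1 by lia.
  by rewrite H; [case: (h _ _); rewrite ?addn0 ?addn1 ?eqxx //; lia | lia].
have eo : o = 2 * o./2 by have := odd_double_half o; rewrite oo; lia.
have tb : o./2 <= b + k by lia.
have [H _] := crossings_count_eq LE g ka tb.
by rewrite {1 2}eo; move: H; case: (h _ _); lia.
Qed.

(** Reflection reverses the order of a pair across a vertical line, so its mirror image starts in
    strip 2a-2-k. *)
Definition refl_invariant (a : nat) (h : tri -> tri -> bool) : Prop :=
  (forall k y, k < 2 * a ->
     h (k, y) (k, y.+1) = h (2 * a - 1 - k, y) (2 * a - 1 - k, y.+1))
  /\ (forall k y, k.+1 < 2 * a ->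
     h (k, y) (k.+1, y) = h (2 * a - 2 - k, y) ((2 * a - 2 - k).+1, y)).

(** * The symmetric tiling of an interlacing chain *)

Definition chain_level (L : nat) (s : seq {set 'I_L}) (k : nat) : {set 'I_L} :=
  nth set0 (set0 :: s) k.

(** Pairs inside a strip are decided by the two neighbouring levels, pairs across a line by
    membership in its level; the right half is read off its mirror image. *)
Definition chain_crit (L a : nat) (s : seq {set 'I_L}) (p q : tri) : bool :=
  if q.1 == p.1
  then chain_vert (chain_level s (left_strip a p.1).+1) (chain_level s (left_strip a p.1)) (p.2 -
    (a - left_strip a p.1))
  else let k := minn p.1 (2 * a - 2 - p.1) in
       [exists i : 'I_L, (i \in chain_level s k.+1) && (p.2 == a - k + 2 * i)].

Definition chain_rel (L a b : nat) (s : seq {set 'I_L}) (p q : tri) : bool :=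
  [&& in_hex a b a p, in_hex a b a q, adj a p q & chain_crit a s p q].

Definition chain_tiling (L a b : nat) (s : seq {set 'I_L}) :
    {set Tri (bnd a b a) * Tri (bnd a b a)} :=
  [set r | chain_rel a b s (tv r.1) (tv r.2)].

Lemma has_pair_chain L a b (s : seq {set 'I_L}) p q :
  has_pair (chain_tiling a b s) p q = chain_rel a b s p q.
Proof.
have hexM t : in_hex a b a t -> t.1 < bnd a b a /\ t.2 < bnd a b a.
  by case: t => k y; rewrite in_hexE /left_strip /bnd /=; lia.
apply/existsP/idP => [[r /and3P[]]|H]; first by rewrite inE => H /eqP<- /eqP<-.
have /and4P[/hexM[p1 p2] /hexM[q1 q2] _ _] := H.
exists ((Ordinal p1, Ordinal p2), (Ordinal q1, Ordinal q2)).
by rewrite inE /tv /= -!surjective_pairing H !eqxx.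
Qed.

Lemma chain_rel_sym L a b (s : seq {set 'I_L}) : refl_invariant a (chain_rel a b s).
Proof.
split=> k y ka; rewrite /chain_rel !in_hexE /chain_crit /= ?eqxx.
  have -> : left_strip a (2 * a - 1 - k) = left_strip a k by rewrite /left_strip; lia.
  have -> : (2 * a - 1 - k < 2 * a) = (k < 2 * a) by lia.
  by congr [&& _, _, _ & _]; rewrite /adj /= !eqxx.
have -> : left_strip a (2 * a - 2 - k) = left_strip a k.+1 by rewrite /left_strip; lia.
have -> : left_strip a (2 * a - 2 - k).+1 = left_strip a k by rewrite /left_strip; lia.
have -> : minn (2 * a - 2 - k) (2 * a - 2 - (2 * a - 2 - k)) = minn k (2 * a - 2 - k) by lia.
rewrite !(gtn_eqF (ltnSn _)) ka (ltnW ka) /=.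
have -> : (2 * a - 2 - k < 2 * a) by lia.
have -> : ((2 * a - 2 - k).+1 < 2 * a) by lia.
rewrite /= andbCA; congr (_ && _); congr (_ && _); congr (_ && _).
rewrite /adj /left_pointing /= !eqxx !(gtn_eqF (ltnSn _)) /= !andbT.
by apply/idP/idP; lia.
Qed.

(** If i in Y were at least m, all of X would lie below i+1, forcing all of Y below i, although i is
    in Y. *)
Lemma interlaces_supp L m (X Y : {set 'I_L}) : interlaces Y X -> (forall i, i \in X -> i < m.+1) ->
  forall i, i \in Y -> i < m.
Proof.
move=> /andP[/eqP c /forallP H] sX i iY; rewrite ltnNge; apply/negP => mi.
have /andP[+ _] := H i; rewrite (count_below_supp sX) // c ltnS leqNgt => /negP[].
have := count_below_le Y i.+1; rewrite count_belowS iY; lia.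
Qed.

Section Chain.
Variables (L a b : nat) (s : seq {set 'I_L}).
Hypotheses (LE : L = a + b) (a0 : 0 < a) (sz : size s = a) (ps : path (@interlaces L) set0 s).

Lemma chain_level_interlaces k : k < a -> interlaces (chain_level s k) (chain_level s k.+1).
Proof. by move=> ka; have /(pathP set0)/(_ k) := ps; rewrite sz => /(_ ka). Qed.

(** Descending induction from line a, where the bound is L = a + b; thus a chain never leaves the
    hexagon. *)
Lemma chain_level_supp k : k <= a -> forall i, i \in chain_level s k -> i < b + k.
Proof.
move=> ka; rewrite -(subKn ka); move: (a - k) (leq_subr k a) => {ka}; elim=> [|d IH] da i.
  by rewrite subn0 addnC -LE => _; exact: ltn_ord.
have il1 := @chain_level_interlaces (a - d.+1) (ltac:(lia)).
apply: (interlaces_supp il1) => j; have -> : (a - d.+1).+1 = a - d by lia.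
by move=> /(IH (ltnW da)); lia.
Qed.

Lemma chain_level_ineq k t : k < a -> t < L ->
  count_below (chain_level s k.+1) t.+1 <= (count_below (chain_level s k) t).+1 /\ count_below
    (chain_level s k) t <= count_below (chain_level s k.+1) t.
Proof.
by move=> ka tL; have /andP[_ /forallP/(_ (Ordinal tL))/andP[]] := chain_level_interlaces ka.
Qed.

Lemma chain_vert_rel k o : k < a -> o <= 2 * (b + k) ->
  chain_rel a b s (k, a - k + o) (k, (a - k + o).+1)
  = chain_vert (chain_level s k.+1) (chain_level s k) o.
Proof.
move=> ka ob; rewrite /chain_rel !in_hexE /chain_crit /adj /= !eqxx /=.
have -> : left_strip a k = k by rewrite /left_strip; lia.
rewrite addKn; have -> : k < 2 * a by lia.
have -> /= : a - k <= a - k + o <= a + 2 * b + k by lia.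
case: (ltnP o (2 * (b + k))) => o1; first by have -> /= : a - k <= (a - k + o).+1 <= a + 2 * b + k
  by lia.
(* The pair leaves the hexagon at the top; [chain_vert] is false there too, since both counts are
   cardinalities and these differ. *)
have -> : o = 2 * (b + k) by lia.
have -> /= : a - k <= (a - k + 2 * (b + k)).+1 <= a + 2 * b + k = false by lia.
have := chain_level_interlaces ka => /andP[/eqP c _].
rewrite /chain_vert mul2n odd_double doubleK.
rewrite (count_below_supp (@chain_level_supp k.+1 ka)) ?addnS // (count_below_supp
  (@chain_level_supp k (ltnW ka))) // c.
by rewrite gtn_eqF.
Qed.

Lemma chain_horiz_rel k t (tL : t < L) : k < a ->
  chain_rel a b s (k, a - k + 2 * t) (k.+1, a - k + 2 * t) = (Ordinal tL \in chain_level s k.+1).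
Proof.
move=> ka; rewrite /chain_rel /chain_crit /= (gtn_eqF (ltnSn _)).
have -> : minn k (2 * a - 2 - k) = k by lia.
apply/idP/idP => [/and4P[_ _ _ /existsP[i /andP[ix /eqP e]]]|H].
  by have -> : Ordinal tL = i by apply: val_inj => /=; lia.
have /= tb := chain_level_supp (ltac:(lia) : k.+1 <= a) H.
apply/and4P; split.
- by rewrite in_hexE /left_strip; lia.
- by rewrite in_hexE /left_strip; lia.
- by rewrite /adj /left_pointing /= !eqxx; lia.
- by apply/existsP; exists (Ordinal tL); rewrite H /= eqxx.
Qed.

(** By parity of the offset, three neighbours are possible partners, and the interlacing
    inequalities make exactly one of them occur. *)
Lemma chain_rel_good_left k y : k < a -> in_hex a b a (k, y) ->
  cover_count (chain_rel a b s) k y = 1.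
Proof.
move=> ka; rewrite in_hexE => hy.
have adjF p q : adj a p q = false -> chain_rel a b s p q = false.
  by move=> e; rewrite /chain_rel e andbF /= andbF.
pose o := y - (a - k); have ey : y = a - k + o by move: hy; rewrite /left_strip /o; lia.
have ob : o <= 2 * (b + k) by move: hy; rewrite /left_strip /o; lia.
move: o ey ob => o ey ob {hy}.
have [t eo] : exists t, o = 2 * t \/ o = (2 * t).+1.
  by exists o./2; have := odd_double_half o; case: (odd o); lia.
rewrite /cover_count {1 2}ey chain_vert_rel //.
case: eo => eo.
  have tL : t < L by lia.
  rewrite [X in _ + nat_of_bool X](adjF) ?addn0; last first.
    by rewrite /adj /left_pointing /= ey; apply/negbTE/negP; lia.
  rewrite ey eo chain_horiz_rel; [|done].
  have [h1 h2] := chain_level_ineq ka tL.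
  have r1 (X : {set 'I_L}) := count_belowS X (Ordinal tL); rewrite /= in r1.
  rewrite {1}/chain_vert mul2n odd_double doubleK.
  have -> : chain_rel a b s (k, (a - k + t.*2).-1) (k,
    a - k + t.*2) = (count_below (chain_level s k.+1) t != count_below (chain_level s k) t).
    case: t tL eo {h1 h2 r1} => [|t] tL eo.
      rewrite !count_below0 eqxx /= addn0 /chain_rel in_hexE; apply/negbTE/negP;
        rewrite /left_strip; lia.
    have -> : (a - k + t.+1.*2) = (a - k + (2 * t).+1).+1 by lia.
    rewrite /= chain_vert_rel //; last by lia.
    by rewrite /chain_vert /= mul2n odd_double /= uphalf_double.
  move: h1 h2; rewrite r1; case: (Ordinal tL \in _); lia.
have tL : t < L by lia.
have tL1 : t.+1 < L by lia.
rewrite [X in _ + nat_of_bool X + _](adjF) ?addn0; last first.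
  by rewrite /adj /left_pointing /= ey; apply/negbTE/negP; lia.
have [h1 h2] := chain_level_ineq ka tL.
have [_ h3] := chain_level_ineq ka tL1.
have r1 (X : {set 'I_L}) := count_belowS X (Ordinal tL); rewrite /= in r1.
have -> : chain_rel a b s (k.-1, y) (k, y) = (Ordinal tL \in chain_level s k).
  case: k ka ey {ob h1 h2 h3} => [|k] ka ey.
    by rewrite inE adjF // /adj /=; apply/negbTE/negP; lia.
  have -> : y = a - k + 2 * t by lia.
  by rewrite chain_horiz_rel //; lia.
have -> : y = (a - k + 2 * t).+1 by lia.
rewrite /= chain_vert_rel //; last by lia.
rewrite eo /chain_vert /= mul2n odd_double /= uphalf_double doubleK.
move: h1 h2 h3; rewrite !r1; case: (_ \in _); case: (_ \in _); lia.
Qed.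

(** The right half follows by reflection, which swaps the last two terms of [cover_count]. *)
Lemma chain_rel_good : perfect_matching a b (chain_rel a b s).
Proof.
split=> [p q /and4P[-> -> -> _] //|k y].
case: (ltnP k a) => ka; first exact: chain_rel_good_left.
move=> hk; have k2 : k < 2 * a by move: hk; rewrite in_hexE; lia.
have [sv sh] := chain_rel_sym a b s.
have hk' : in_hex a b a (2 * a - 1 - k, y) by move: hk; rewrite !in_hexE /left_strip; lia.
rewrite -(chain_rel_good_left (ltac:(lia) : 2 * a - 1 - k < a) hk') /cover_count.
have y0 : 0 < y by move: hk; rewrite in_hexE /left_strip; lia.
have F1 : chain_rel a b s (0, y) (0, y) = false.
  by rewrite /chain_rel /adj /= (ltn_eqF (ltnSn y)) /= !andbF.
have F2 : chain_rel a b s (k, y) (k.+1, y) = chain_rel a b s ((2 * a - 1 - k).-1,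
  y) (2 * a - 1 - k, y).
  case: (ltnP k.+1 (2 * a)) => k1.
    rewrite sh //; have -> : (2 * a - 2 - k).+1 = 2 * a - 1 - k by lia.
    by have -> : (2 * a - 1 - k).-1 = 2 * a - 2 - k by lia.
  have -> : 2 * a - 1 - k = 0 by lia.
  rewrite /= F1 /chain_rel [in_hex _ _ _ (k.+1, _)]in_hexE.
  have -> : (k.+1 < 2 * a) = false by lia.
  by rewrite /= andbF.
have F3 : chain_rel a b s (k.-1, y) (k, y) = chain_rel a b s (2 * a - 1 - k,
  y) ((2 * a - 1 - k).+1, y).
  have := sh k.-1 y (ltac:(lia)); rewrite prednK; last by lia.
  by have -> : 2 * a - 2 - k.-1 = 2 * a - 1 - k by lia.
have F4 : chain_rel a b s (k, y.-1) (k, y)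
        = chain_rel a b s (2 * a - 1 - k, y.-1) (2 * a - 1 - k, y).
  by have := sv k y.-1 k2; rewrite prednK.
by rewrite sv // F2 F3 F4 -!addnA; congr (_ + (_ + _)); rewrite addnC.
Qed.

End Chain.

Lemma strip_offset_half a m y : m < a -> a - m <= y -> ~~ odd (y + m + a) ->
  y = a - m + 2 * (y - (a - m))./2.
Proof.
move=> ma my; have -> : y + m + a = (y - (a - m)) + a.*2 by lia.
rewrite oddD odd_double addbF => od.
by rewrite mul2n even_halfK // subnKC.
Qed.

(** A symmetric tiling is determined by its crossings: every pair is reflected into the left half,
    where [matching_vert] or the definition of [crossings] decides it. *)
Lemma matching_chain_rel L a b (h : tri -> tri -> bool) (s : seq {set 'I_L}) : L = a + b ->
  0 < a -> perfect_matching a b h -> refl_invariant a h -> (forall k,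
    k <= a -> chain_level s k = crossings L a h k) ->
  forall p q, h p q = chain_rel a b s p q.
Proof.
move=> LE a0 g [sv sh] hl [k y] [k' y']; rewrite /chain_rel.
case hp: (in_hex a b a (k, y)); last by rewrite (matching_hexF1 _ g).
case hq: (in_hex a b a (k', y')); last by rewrite (matching_hexF2 _ g).
case apq: (adj a (k, y) (k', y')); last by rewrite (matching_adjF g).
rewrite /chain_crit /=; move: (apq); rewrite /adj /=.
move=> /orP[/andP[/eqP ek /eqP ey]|/and3P[lp /eqP ek /eqP ey]]; subst k' y'.
  rewrite eqxx; move: hp hq; rewrite !in_hexE => hp hq.
  have -> : h (k, y) (k, y.+1) = h (left_strip a k, y) (left_strip a k, y.+1).
    rewrite /left_strip; case: (leqP k (2 * a - 1 - k)) => km; first by [].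
    by rewrite sv //; lia.
  have mka : left_strip a k < a by move: hp; rewrite /left_strip; lia.
  rewrite !hl //; last by exact: ltnW.
  have -> : y = a - left_strip a k + (y - (a - left_strip a k)) by lia.
  by rewrite addKn (matching_vert LE g) //; lia.
rewrite (gtn_eqF (ltnSn k)); set m := minn _ _.
move: hp hq; rewrite !in_hexE => hp hq.
have ma : m < a by rewrite /m; lia.
have -> : h (k, y) (k.+1, y) = h (m, y) (m.+1, y).
  rewrite /m; case: (leqP k (2 * a - 2 - k)) => km; first by [].
  by rewrite sh //; lia.
have /andP[h1 h2] : a - m <= y <= a + 2 * b + m by move: hp hq; rewrite /left_strip /m; lia.
have pm : ~~ odd (y + m + a).
  move: lp; rewrite /left_pointing /= /m; case: (leqP k (2 * a - 2 - k)) => // km.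
  have -> : y + k + a = y + (2 * a - 2 - k) + a + (k - (a - 1)).*2 by lia.
  by rewrite oddD odd_double addbF.
rewrite hl //= {hl sv sh g apq lp hp hq}; apply/idP/existsP => [H|[i /andP[+ /eqP->]]];
  last by rewrite inE.
have ey := strip_offset_half ma h1 pm.
have tL : (y - (a - m))./2 < L.
  by move: ey h2; move: (_./2) => t; lia.
by exists (Ordinal tL); rewrite inE /= -ey H eqxx.
Qed.

Lemma has_tileE M (S : {set Tri M * Tri M}) p q : has_tile M S p q = has_pair S p q || has_pair S q
  p.
Proof.
apply/existsP/orP => [[r /andP[rS /orP[H|H]]]|[/existsP[r /andP[rS H]]|/existsP[r /andP[rS H]]]].
- by left; apply/existsP; exists r; rewrite rS.
- by right; apply/existsP; exists r; rewrite rS.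
- by exists r; rewrite rS H.
- by exists r; rewrite rS H orbT.
Qed.

Lemma vsymP a b (S : {set Tri (bnd a b a) * Tri (bnd a b a)}) : perfect_matching a b (has_pair S) ->
  vsym a (bnd a b a) S <-> refl_invariant a (has_pair S).
Proof.
move=> g; split=> [/forallP H|[sv sh]].
  have H' p q : has_pair S p q -> has_pair S (refl a p) (refl a q) || has_pair S (refl a q) (refl a
    p).
    move=> /existsP[r /and3P[rS /eqP<- /eqP<-]]; rewrite -has_tileE.
    by have /implyP/(_ rS) := H r.
  have hv k y : k < 2 * a -> has_pair S (k, y) (k, y.+1) ->
      has_pair S (2 * a - 1 - k, y) (2 * a - 1 - k, y.+1).
    move=> ka /H'; rewrite /refl /= => /orP[//|].
    by rewrite (matching_adjF g) // /adj /=; apply/negbTE/negP; lia.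
  have hh k y : k.+1 < 2 * a -> has_pair S (k, y) (k.+1, y) ->
      has_pair S (2 * a - 2 - k, y) ((2 * a - 2 - k).+1, y).
    move=> ka /H'; rewrite /refl /=.
    have -> : 2 * a - 1 - k.+1 = 2 * a - 2 - k by lia.
    have -> : 2 * a - 1 - k = (2 * a - 2 - k).+1 by lia.
    case/orP=> //; rewrite (matching_adjF g) // /adj /=; apply/negbTE/negP; lia.
  split=> k y ka; apply/idP/idP; [exact: hv| |exact: hh|].
    move=> /hv; rewrite (_ : 2 * a - 1 - (2 * a - 1 - k) = k); last by lia.
    by apply; lia.
  move=> /hh; rewrite (_ : 2 * a - 2 - (2 * a - 2 - k) = k); last by lia.
  by apply; lia.
apply/forallP => r; apply/implyP => /has_pair_mem H; rewrite has_tileE.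
have [+ _ +] := g.1 _ _ H; move: H; case: (tv r.1) (tv r.2) => [k y] [k' y'] H.
rewrite in_hexE /refl /adj /= => hk.
move=> /orP[/andP[/eqP ek /eqP ey]|/and3P[lp /eqP ek /eqP ey]]; subst k' y'.
  by rewrite -sv ?H //; lia.
have k1 : k.+1 < 2 * a by have [_ + _] := g.1 _ _ H; rewrite in_hexE; lia.
apply/orP; right; rewrite (_ : 2 * a - 1 - k.+1 = 2 * a - 2 - k); last by lia.
rewrite (_ : 2 * a - 1 - k = (2 * a - 2 - k).+1); last by lia.
by rewrite -sh.
Qed.

(** Position i on line a is at doubled height 1 + 2i, so the central rhombus, at height a + b, is
    position o. *)
Lemma centeredE L a b (o : 'I_L) (S : {set Tri (bnd a b a) * Tri (bnd a b a)}) :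
  0 < a -> a + b = 2 * o + 1 -> perfect_matching a b (has_pair S) ->
  centered a b (bnd a b a) S = (o \in crossings L a (has_pair S) a).
Proof.
move=> a0 oE g; rewrite /centered has_tileE orbC (matching_adjF g) /=; last first.
  by rewrite /adj /=; apply/negbTE/negP; lia.
case: a a0 S g oE => // a a0 S g oE; rewrite /crossings inE.
have -> : a.+1 - a + 2 * o = a.+1 + b by lia.
by rewrite subn1.
Qed.

Lemma card_eq_can (T T' : finType) (A : {set T}) (B : {set T'}) (f : T -> T') (g : T' -> T) :
  (forall x, x \in A -> f x \in B /\ g (f x) = x) ->
  (forall y, y \in B -> g y \in A /\ f (g y) = y) -> #|A| = #|B|.
Proof.
move=> fA gB; rewrite -(@card_in_imset _ _ f A); last first.
  by move=> x y /fA[_ ex] /fA[_ ey] e; rewrite -ex -ey e.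
apply: eq_card => y; apply/imsetP/idP => [[x /fA[fx _] ->] //|/gB[gy e]].
by exists (g y).
Qed.

(** Taking crossings and [chain_tiling] are mutually inverse between symmetric tilings and
    chains. *)
Lemma num_cvs_chains L a b (o : 'I_L) : L = a + b -> 0 < a -> a + b = 2 * o + 1 ->
  num_cvs a b = \sum_(X : {set 'I_L} | o \in X) #|chains a X|.
Proof.
move=> LE a0 oE.
pose B := [set s : a.-tuple {set 'I_L} | path (@interlaces L) set0 s & o \in last set0 s].
pose f (S : {set Tri (bnd a b a) * Tri (bnd a b a)}) : a.-tuple {set 'I_L} :=
  [tuple crossings L a (has_pair S) i.+1 | i < a].
have lvl_f S k : k <= a -> chain_level (f S) k = crossings L a (has_pair S) k.
  case: k => [|k] ka //; rewrite /chain_level /=.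
  by have := nth_mktuple (fun i : 'I_a => crossings L a (has_pair S) i.+1) set0 (Ordinal ka).
have last_lvl (s : a.-tuple {set 'I_L}) : last set0 s = chain_level s a.
  by rewrite (last_nth set0) size_tuple.
transitivity #|B|; last first.
  rewrite -sum1_card (partition_big (fun s : a.-tuple {set 'I_L} => last set0 s)
    (fun X => o \in X)) /=; last by move=> s; rewrite inE => /andP[].
  apply: eq_bigr => X oX; rewrite sum1dep_card; apply: eq_card => s; rewrite !inE -andbA.
  by case: eqP => [->|]; rewrite ?oX ?andbF.
apply: (@card_eq_can _ _ _ _ f (fun s => chain_tiling a b s)) => [S|s].
  rewrite inE => /and3P[/is_tilingP g /(vsymP g) sy]; rewrite (centeredE a0 oE g) => oS.
  split.
    rewrite inE last_lvl lvl_f // oS andbT.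
    apply/(pathP set0) => k; rewrite size_tuple => ka.
    have := matching_interlaces LE g ka; rewrite -(lvl_f S k (ltnW ka)) -(lvl_f S k.+1 ka).
    by [].
  apply/setP => r; rewrite -[LHS]has_pairE -[RHS]has_pairE has_pair_chain.
  by rewrite (matching_chain_rel LE a0 g sy (lvl_f S)).
rewrite inE => /andP[ps os].
have sz := size_tuple s.
have g0 := chain_rel_good LE a0 sz ps.
have gE : has_pair (chain_tiling a b s) =2 chain_rel a b s by move=> p q; exact: has_pair_chain.
have g : perfect_matching a b (has_pair (chain_tiling a b s)).
  split=> [p q|k y]; rewrite ?gE; first exact: g0.1.
  by rewrite /cover_count !gE; exact: g0.2.
have sy : refl_invariant a (has_pair (chain_tiling a b s)).
  have [sv sh] := chain_rel_sym a b s.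
  by split=> k y ka; rewrite !gE; [exact: sv | exact: sh].
have xl k : k <= a -> crossings L a (has_pair (chain_tiling a b s)) k = chain_level s k.
  case: k => [|k] ka //; apply/setP => -[t tL].
  by rewrite inE /= gE chain_horiz_rel.
have fs : f (chain_tiling a b s) = s.
  apply: eq_from_tnth => i; rewrite tnth_mktuple xl // (tnth_nth set0) //.
split=> //; rewrite inE (centeredE a0 oE g) xl // -last_lvl os andbT.
by apply/andP; split; [apply/is_tilingP | apply/(vsymP g)].
Qed.

Local Open Scope ring_scope.

(** * The product formula *)

(** Closed form of the quotient of [vdm_sum N a.+1] by [vdm_sum N a] for a <= 2N. *)
Definition vdm_sum_ratio (N a : nat) : rat :=
  ratfact a ^+ 2 / ratfact (2 * a).+1
  * \prod_(k < a.+1) (2 * N%:R + 1 - a%:R + 2 * k%:R).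

(** The product gains a factor at each end, together (2N+1)^2 - (a+2)^2, which occurs in
    [cheb_coef N a.+2]. *)
Lemma vdm_sum_ratioSS N a :
  vdm_sum_ratio N a.+2 = (a%:R + 1) / (a%:R + 2) * cheb_coef N a.+2 * vdm_sum_ratio N a.
Proof.
rewrite /vdm_sum_ratio big_ord_recr big_ord_recl /=.
rewrite (eq_bigr (fun k : 'I_a.+1 => 2 * N%:R + 1 - a%:R + 2 * k%:R)) => [|k _]; last first.
  by rewrite /bump /= add1n -[k.+1]addn1 -[a.+2]addn2 !natrD; ring.
rewrite (_ : (2 * a.+2).+1 = (2 * a).+1.+4)%N; last by lia.
rewrite !(ratfactS (2 * a).+4) !(ratfactS (2 * a).+3) !(ratfactS (2 * a).+2)
  !(ratfactS (2 * a).+1) !(ratfactS a.+1) !(ratfactS a) /cheb_coef.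
have := ratfact_neq0 a; have := ratfact_neq0 (2 * a).+1.
move: (\prod_(i < _) _) (ratfact _) (ratfact _) => P f g g0 f0.
rewrite -[(2 * a).+4]addn4 -[(2 * a).+3]addn3 -[(2 * a).+2]addn2 -[(2 * a).+1]addn1
  -[a.+2]addn2 -[a.+1]addn1 !(natrM, natrD).
have a0 : 0 <= a%:R :> rat by [].
move: (a%:R : rat) (N%:R : rat) a0 => c m c0.
field; rewrite ?f0 ?g0 /=; repeat (apply/andP; split);
  (assumption || (apply: lt0r_neq0; nra)).
Qed.

(** Both sides satisfy the same two-step recurrence in a, by [cnormS] on the left and by
    [vdm_sum_ratioSS] and [hcheb_atN] on the right. *)
Lemma cnorm_vdm_sum_ratio N a : cnorm N a = vdm_sum_ratio N a * (2 * (half_cheb N a).[N%:R]).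
Proof.
suff: cnorm N a = vdm_sum_ratio N a * (2 * (half_cheb N a).[N%:R]) /\
      cnorm N a.+1 = vdm_sum_ratio N a.+1 * (2 * (half_cheb N a.+1).[N%:R]) by case.
elim: a => [|a [H0 H1]].
  rewrite cnormS cnorm0 hcheb0_eval hcheb1_eval /vdm_sum_ratio !big_ord_recl !big_ord0 /cheb_coef.
  rewrite muln0 muln1 !ratfactS (_ : ratfact 0 = 1) //= /bump /=.
  by split; field.
split=> //; rewrite !cnormS H0 vdm_sum_ratioSS hcheb_atN.
have a0 : 0 <= a%:R :> rat by [].
by field; apply/andP; split; apply: lt0r_neq0; lra.
Qed.

Lemma hcheb_atN_gt0 N a : (a <= 2 * N)%N -> 0 < (half_cheb N a).[N%:R].
Proof.
suff: ((a <= 2 * N)%N -> 0 < (half_cheb N a).[N%:R]) /\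
      ((a.+1 <= 2 * N)%N -> 0 < (half_cheb N a.+1).[N%:R]) by case.
elim: a => [|a [H0 H1]].
  rewrite hcheb0_eval hcheb1_eval; split=> // _.
  by have : 0 <= N%:R :> rat by []; lra.
split=> // aN; rewrite hcheb_atN; have a0 : 0 <= a%:R :> rat by [].
rewrite mulr_gt0 ?H0 //; last by lia.
rewrite mulr_gt0 ?cheb_coef_gt0 //; last by lia.
by apply: divr_gt0; lra.
Qed.

(** Numerator of ST in terms of m = a + b, which stays fixed as a grows in the recurrence; the
    diagonal i = j is the single product of ST. *)
Definition st_num (m : rat) (a : nat) : rat :=
  \prod_(j < a) \prod_(i < j.+1) (m - a%:R + i%:R + j%:R + 1).

Definition st_den (a : nat) : rat :=
  \prod_(j < a) \prod_(i < j.+1) (i%:R + j%:R + 1).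

(** Raising a by one lowers every factor by one: entries off the diagonal become those for a with j
    shifted, and the diagonal gives the new product. *)
Lemma st_numS m a :
  st_num m a.+1 = st_num m a * \prod_(k < a.+1) (m - a%:R + 2 * k%:R).
Proof.
rewrite /st_num (eq_bigr (fun j : 'I_a.+1 =>
  (\prod_(i < j) (m - a%:R + i%:R + j%:R)) * (m - a%:R + 2 * j%:R))); last first.
  move=> j _; rewrite big_ord_recr /= (_ : a.+1%:R = a%:R + 1 :> rat); last by rewrite natr1.
  by congr (_ * _); [apply: eq_bigr => i _|]; ring.
rewrite big_split; congr (_ * _); rewrite big_ord_recl /= big_ord0 mul1r.
apply: eq_bigr => j _; apply: eq_bigr => i _.
by rewrite -[RHS]addrA natr1.
Qed.

Lemma st_denS a : st_den a.+1 * ratfact a = st_den a * ratfact (2 * a).+1.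
Proof.
rewrite /st_den big_ord_recr /= -mulrA; congr (_ * _).
have H k : (\prod_(i < k) (i%:R + a%:R + 1)) * ratfact a = ratfact (k + a) :> rat.
  elim: k => [|k IH]; first by rewrite big_ord0 mul1r.
  by rewrite big_ord_recr /= mulrAC IH addSn ratfactS natrD mulrC.
by rewrite H; congr ratfact; lia.
Qed.

Lemma st_den_neq0 a : st_den a != 0.
Proof.
apply/prodf_neq0 => j _; apply/prodf_neq0 => i _.
by rewrite -natrD natr1 pnatr_eq0.
Qed.

Lemma ST_frac a b : ST a b = st_num (a + b)%:R a / st_den a.
Proof.
rewrite /ST /st_num /st_den !big_add1 !big_mkord /= -big_split -prodf_div.
apply: eq_bigr => j _ /=; rewrite -prodf_div big_ord_recr /= mulrC big_add1 big_mkord /=.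
have cast (u v w : nat) : (u + v + 1 = w)%N -> w%:R = u%:R + v%:R + 1 :> rat.
  by move=> <-; rewrite !natrD.
congr (_ * _).
  apply: eq_bigr => i _; congr (_ / _).
    by rewrite (_ : _ - 1 = i + j + b + 1)%N ?natrD; [ring | lia].
  by apply: cast; lia.
congr (_ / _); last by apply: cast; lia.
by rewrite (_ : _ - 1 = j + j + b + 1)%N ?natrD; [ring | lia].
Qed.

Lemma vdm_sum_closed N a : (a <= (2 * N).+1)%N ->
  vdm_sum N a = (\prod_(i < a) i`!)%:R * (st_num (2 * N%:R + 1) a / st_den a).
Proof.
elim: a => [_|a IH aN].
  rewrite /vdm_sum (big_pred1 set0) => [|X]; last by rewrite cards_eq0.
  by rewrite /vdm_prod big_set0 /st_num /st_den !big_ord0 invr1 ?mulr1 ?mul1r.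
have h0 := hcheb_atN_gt0 (ltac:(lia) : (a <= 2 * N)%N).
have := vdm_sum_rec N a; rewrite cnorm_vdm_sum_ratio mulrA => /mulIf -> ; last first.
  by apply: lt0r_neq0; lra.
rewrite IH; last by lia.
rewrite big_ord_recr /= natrM st_numS -/(ratfact a) /vdm_sum_ratio.
have f1 := ratfact_neq0 a; have f2 := ratfact_neq0 (2 * a).+1.
have d1 := st_den_neq0 a; have d2 := st_den_neq0 a.+1.
rewrite (_ : st_den a.+1 = st_den a * ratfact (2 * a).+1 / ratfact a); last first.
  by rewrite -st_denS mulfK.
move: (\prod_(k < a.+1) _) ((_)%:R) (st_num _ _) => p1 p2 p3.
by field; rewrite f1 f2 d1.
Qed.

Theorem theorem2 (n x : nat) : (1 <= x)%N ->
  ((num_cvs (2 * n + 1) (2 * x))%:R : rat)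
  = (Q n.+1 x * ST (2 * n + 1) (2 * x))%R.
Proof.
(* With N = n + x, the a + 2x positions on the symmetry axis are the 2N+1 sites, and the central
   rhombus is at site 0. *)
move=> x1; set a := (2 * n + 1)%N; pose N := (n + x)%N.
have oL : (N < (2 * N).+1)%N by lia.
pose o : 'I_(2 * N).+1 := Ordinal oL.
rewrite (@num_cvs_chains (2 * N).+1 a (2 * x) o); [|rewrite /a /N /=; lia ..].
have F0 : (\prod_(i < a) i`!)%:R != 0 :> rat.
  by rewrite natr_prod; apply/prodf_neq0 => i _; rewrite pnatr_eq0 -lt0n fact_gt0.
(* Multiplying by 0! 1! ... (a-1)! turns the numbers of chains into Vandermonde products. *)
apply: (mulIf F0); rewrite natr_sum mulr_suml.
rewrite (eq_bigr (fun X : {set 'I_(2 * N).+1} => if #|X| == a then vdm_prod X else 0)); last first.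
  by move=> X _; exact: card_chains.
rewrite -big_mkcondr Q_kernel0 -/N.
have aE : a = (2 * n).+1 by rewrite /a addn1.
rewrite (eq_bigl (fun X : {set 'I_(2 * N).+1} => (#|X| == (2 * n).+1) && (o \in X))); last first.
  by move=> X; rewrite andbC aE.
rewrite (@vdm_sum_centered N n o) //; last by rewrite /N; lia.
rewrite vdm_sum_closed; last by rewrite /N; lia.
rewrite -aE ST_frac (_ : (a + 2 * x)%:R = 2 * N%:R + 1).
  by rewrite mulrCA mulrC mulrA.
have -> : (a + 2 * x = 2 * N + 1)%N by rewrite /a /N; lia.
by rewrite natrD natrM.
Qed.
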